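(* One has $\mathring\mu_4(2|2)_1=3$.
   Context: A subspace of $\mathbb{R}^n$ is rational if it has a basis of vectors with rational coordinates; $\mathfrak{R}_n(e)$ denotes the set of rational subspaces of $\mathbb{R}^n$ of dimension $e$. A subspace $A$ of $\mathbb{R}^n$ is $(e,j)$-irrational if $\dim(A\cap B)<j$ for all $B\in\mathfrak{R}_n(e)$; $\mathfrak{I}_n(d,e)_j$ denotes the set of all $(e,j)$-irrational subspaces of dimension $d$ of $\mathbb{R}^n$. Height: for $B\in\mathfrak{R}_n(e)$, let $\Xi\in\mathbb{Z}^N$, $N=\binom ne$, be a vector of Pl\''ucker coordinates of $B$ which is integral with setwise coprime coordinates; $H(B)=\Vert\Xi\Vert$ (Euclidean norm). Equivalently $H(B)$ is the covolume of $B\cap\mathbb{Z}^n$ in $B$. Proximity: $\mathbb{R}^n$ has its standard Euclidean structure. For nonzero $X,Y\in\mathbb{R}^n$, $\psi(X,Y)=\Vert X\wedge Y\Vert/(\Vert X\Vert\,\Vert Y\Vert)$ is the sine of the angle between $X$ and $Y$. For subspaces $A,B$ of $\mathbb{R}^n$ of dimensions $d,e\ge 1$ and $t=\min(d,e)$, define inductively $\psi_1(A,B)=\min\{\psi(X,Y): X\in A\setminus\{0\},Y\in B\setminus\{0\}\}$, attained at unit vectors $X_1\in A$, $Y_1\in B$; and, given $(X_1,Y_1),\dots,(X_j,Y_j)$ with $j<t$, let $A_j$ (resp. $B_j$) be the orthogonal complement of $\mathrm{Span}(X_1,\dots,X_j)$ in $A$ (resp. of $\mathrm{Span}(Y_1,\dots,Y_j)$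 in $B$), and $\psi_{j+1}(A,B)=\min\{\psi(X,Y): X\in A_j\setminus\{0\},Y\in B_j\setminus\{0\}\}$, attained at unit vectors $X_{j+1},Y_{j+1}$. (These are the sines of the canonical angles between $A$ and $B$ and do not depend on the choices.) Exponents: let $n\ge 2$, $d,e\in\{1,\dots,n-1\}$ with $d+e\le n$, $j\in\{1,\dots,\min(d,e)\}$. For $A\in\mathfrak{I}_n(d,e)_j$, $\mu_n(A|e)_j\in[0,+\infty]$ is the supremum of all $\beta>0$ such that $\psi_j(A,B)\le H(B)^{-\beta}$ holds for infinitely many $B\in\mathfrak{R}_n(e)$. Set $\mathring\mu_n(d|e)_j=\inf_{A\in\mathfrak{I}_n(d,e)_j}\mu_n(A|e)_j$. *)

(* Defs.v *)
(* Subspaces of R^n are terms of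
   {vspace 'rV[R]_n}, for which Leibniz equality is equality of subspaces. *)
From HB Require Import structures.
From mathcomp Require Import all_boot all_order all_algebra.
From mathcomp Require Import all_classical all_reals all_analysis.
Set Implicit Arguments.
Unset Strict Implicit.
Unset Printing Implicit Defensive.
Import Order.TTheory GRing.Theory Num.Theory.
Local Open Scope classical_set_scope.
Local Open Scope ring_scope.

Section Subspaces.
Variables (R : realType) (n : nat).
Implicit Types (A B : {vspace 'rV[R]_n}) (d e j : nat).

Definition rational_subspaces e : set {vspace 'rV[R]_n} :=
  [set B | exists M : 'M[rat]_(e, n),
     basis_of B [tuple row i (map_mx ratr M) | i < e]].

Definition irrational_subspaces d e j : set {vspace 'rV[R]_n} :=
  [set A | \dim A = d /\
     forall B, rational_subspaces e B -> (\dim (A :&: B) < j)%N].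

(* Strictly increasing maps 'I_e -> 'I_n, i.e. the 'C(n, e) column choices that
   index the Pluecker coordinates of an e-dimensional subspace. *)
Definition plucker_index e : predArgType :=
  {f : {ffun 'I_e -> 'I_n} |
    [forall i : 'I_e, forall k : 'I_e, (i < k)%N ==> (f i < f k)%N]}.

Definition plucker e (M : 'M[R]_(e, n)) (f : plucker_index e) : R :=
  \det (colsub (val f) M).

Definition primitive_plucker e B (Xi : plucker_index e -> int) : Prop :=
  (exists M : 'M[R]_(e, n),
     basis_of B [tuple row i M | i < e] /\
     forall f, plucker M f = (Xi f)%:~R) /\
  \big[gcdn/0%N]_(f : plucker_index e) `|Xi f|%N = 1%N.

(* For B rational of dimension e, the vector Xi exists and is unique up to
   sign, so xget selects the only value; the default 0 is never used there. *)
Definition height e B : R :=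
  xget 0 [set h | exists2 Xi : plucker_index e -> int, primitive_plucker B Xi &
            h = Num.sqrt (\sum_f (Xi f)%:~R ^+ 2)].

(* The norm `|x| of the library on 'rV[R]_n is the sup norm. *)
Definition enorm (x : 'rV[R]_n) : R := Num.sqrt (\sum_i x 0 i ^+ 2).

Definition wedge_norm (x y : 'rV[R]_n) : R :=
  Num.sqrt (\sum_(p : 'I_n * 'I_n | (p.1 < p.2)%N)
    (x 0 p.1 * y 0 p.2 - x 0 p.2 * y 0 p.1) ^+ 2).

Definition psi (x y : 'rV[R]_n) : R := wedge_norm x y / (enorm x * enorm y).

(* The infimum is a minimum when A and B are nonzero, by compactness of the
   unit spheres of A and B. *)
Definition psi_min A B : R :=
  inf [set r | exists x y, [/\ x \in A, x != 0, y \in B, y != 0 & r = psi x y]].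

Definition minimizing_pairs A B : set ('rV[R]_n * 'rV[R]_n) :=
  [set p | [/\ p.1 \in A, enorm p.1 = 1, p.2 \in B, enorm p.2 = 1 &
              psi p.1 p.2 = psi_min A B]].

Definition orthogonal_of (v : 'rV[R]_n) : {vspace 'rV[R]_n} :=
  lker (linfun (mulmxr v^T : 'rV[R]_n -> 'rV[R]_1)).

(* From (A_k, B_k) to (A_(k+1), B_(k+1)): choose a minimizing pair (X, Y) and
   keep the vectors of A_k orthogonal to X and those of B_k orthogonal to Y. *)
Definition canonical_step (C : {vspace 'rV[R]_n} * {vspace 'rV[R]_n}) :=
  let p := xget (0, 0) (minimizing_pairs C.1 C.2) in
  ((C.1 :&: orthogonal_of p.1)%VS, (C.2 :&: orthogonal_of p.2)%VS).

(* Indexed from j = 1, with (A_0, B_0) = (A, B). *)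
Definition psi_sub j A B : R :=
  let C := iter j.-1 canonical_step (A, B) in psi_min C.1 C.2.

(* The supremum is taken in [0, +oo]: it is 0 when no b > 0 qualifies, whereas
   ereal_sup set0 = -oo. *)
Definition mu A e j : \bar R :=
  maxe 0%E (ereal_sup [set b%:E | b in [set b : R | 0 < b /\
    infinite_set [set B | rational_subspaces e B /\
                          psi_sub j A B <= height e B `^ (- b)]]]).

Definition mu_inf d e j : \bar R :=
  ereal_inf [set mu A e j | A in irrational_subspaces d e j].

End Subspaces.

(* Main.v *)
(** Lower bound: for an irrational plane A, Dirichlet's box principle gives
    x <> 0 in Z^4 with |x| <= Q at distance O(1/Q) from A. Choose x with |x| = X
    minimal. Simultaneous approximation of the ratios of the coordinates of x
    then gives an integer point z with |x /\ z| = O(X^(2/3)), independent of x by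
    minimality, so B = <x, z> satisfies H(B)^3 = O(X^2) and
    psi_1(A, B) = O(1/(QX)) = O(H(B)^-3).

    Upper bound: let A be the plane with Pluecker coordinates
    (p12, p13, p14, p23, p24, p34) = (a, b, 1, -3, -b, a), a^2 + b^2 = 3. For B with
    Pluecker coordinates Xi, psi_1(A, B) is at least |L(Xi)|/(4 H(B)), where L is a
    linear form with coefficients a, b, 1 in three integers m1, m2, m3 depending on
    Xi. They are not all 0 because x^2 + y^2 = 3 z^2 has no nontrivial integer
    solution. The same fact makes the discriminant of the
    quadratic polynomial t |-> (1 + t^2) L in a rational parameter t of the circle a
    nonzero integer, so a Borel-Cantelli argument yields t with
    |L| >= c |m|^(-2-eps). *)
Require Import Defs.
From mathcomp Require Import all_boot all_order all_algebra.
From mathcomp Require Import all_classical all_reals all_analysis.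
From mathcomp Require Import ring lra zify.
Set Implicit Arguments.
Unset Strict Implicit.
Unset Printing Implicit Defensive.
Import Order.TTheory GRing.Theory Num.Theory.
Local Open Scope classical_set_scope.
Local Open Scope ring_scope.

(** * Minors of two vectors *)

Section Wedge.
Variables (R : realType) (n : nat).
Implicit Types (x y r s : 'rV[R]_n) (B : {vspace 'rV[R]_n}).

Definition minor x y (i j : 'I_n) : R := x 0 i * y 0 j - x 0 j * y 0 i.

Lemma minorC x y i j : minor x y j i = - minor x y i j.
Proof. by rewrite /minor opprB. Qed.

Lemma minor_comb r s (a b c d : R) i j :
  minor (a *: r + b *: s) (c *: r + d *: s) i j = (a * d - b * c) * minor r s i j.
Proof. by rewrite /minor !mxE; ring. Qed.

Lemma minor_wedge_le x y i j : `|minor x y i j| <= wedge_norm x y.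
Proof.
wlog lij : i j / (i < j)%N.
  move=> H; have [/H //|lji|/val_inj->] := ltngtP i j.
    by rewrite minorC normrN; apply: H.
  by rewrite /minor subrr normr0 sqrtr_ge0.
rewrite -sqrtr_sqr ler_sqrt; last by apply: sumr_ge0 => p _; apply: sqr_ge0.
rewrite (bigD1 (i, j)) //= lerDl; apply: sumr_ge0 => p _; exact: sqr_ge0.
Qed.

Lemma wedge_norm_ge0 x y : 0 <= wedge_norm x y.
Proof. exact: sqrtr_ge0. Qed.

Lemma wedge_norm_sqr x y :
  wedge_norm x y ^+ 2 = \sum_(p : 'I_n * 'I_n | (p.1 < p.2)%N) minor x y p.1 p.2 ^+ 2.
Proof. by rewrite sqr_sqrtr //; apply: sumr_ge0 => p _; apply: sqr_ge0. Qed.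

Lemma wedge_norm_scale r s x y (k : R) :
  (forall i j, minor x y i j = k * minor r s i j) ->
  wedge_norm x y = `|k| * wedge_norm r s.
Proof.
move=> H; apply/eqP; rewrite -(eqrXn2 (n := 2)) // ?wedge_norm_ge0 ?mulr_ge0 ?wedge_norm_ge0 //.
rewrite exprMn !wedge_norm_sqr real_normK ?num_real // mulr_sumr.
by apply/eqP/eq_bigr => p _; rewrite H exprMn.
Qed.

Lemma memv_span2 x y (v : 'rV[R]_n) :
  v \in <<[:: x; y]>>%VS -> exists a b, v = a *: x + b *: y.
Proof.
rewrite span_cons span_seq1 => /memv_addP[u /vlineP[a ->]] [w /vlineP[b ->] ->].
by exists a, b.
Qed.

Lemma free2_minor x y : free [:: x; y] <-> exists i j, minor x y i j != 0.
Proof.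
rewrite free_cons seq1_free span_seq1; split.
  case/andP => hx hy; apply: contrapT => H.
  have [i yi] : exists i, y 0 i != 0.
    apply: contrapT => h; case/eqP: hy; apply/rowP => i; rewrite mxE.
    by apply: contrapT => /eqP hi; apply: h; exists i.
  case/negP: hx; apply/vlineP; exists (x 0 i / y 0 i); apply/rowP => j; rewrite mxE.
  have /eqP : minor x y i j = 0.
    by apply: contrapT => /eqP h; apply: H; exists i, j.
  rewrite /minor subr_eq0 => /eqP h; rewrite mulrAC h; field.
  by [].
case=> i [j h]; apply/andP; split.
  apply/negP => /vlineP[k e]; case/eqP: h; rewrite /minor e !mxE; ring.
by apply/eqP => e; case/eqP: h; rewrite /minor e !mxE; ring.
Qed.

Lemma mem_span2 x y (a b : R) : a *: x + b *: y \in <<[:: x; y]>>%VS.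
Proof. by rewrite memvD // memvZ // memv_span // !inE eqxx ?orbT. Qed.

Lemma rows2 (M : 'M[R]_(2, n)) :
  [tuple row i M | i < 2] = [:: row ord0 M; row ord_max M] :> seq _.
Proof.
rewrite /= enum_ordSl enum_ordSl /= (_ : enum 'I_0 = [::]); last first.
  by apply/eqP; rewrite -size_eq0 size_enum_ord.
by rewrite /=; congr [:: _; row _ _]; apply: val_inj.
Qed.

Lemma basis2P B (M : 'M[R]_(2, n)) :
  basis_of B [tuple row i M | i < 2] <->
  B = <<[:: row ord0 M; row ord_max M]>>%VS /\
  exists i j, minor (row ord0 M) (row ord_max M) i j != 0.
Proof.
rewrite /basis_of rows2 -free2_minor; split=> [/andP[/eqP <- ->] //|[-> ->]].
by rewrite eqxx.
Qed.

Definition pidx (i j : 'I_n) : {ffun 'I_2 -> 'I_n} :=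
  [ffun k => if k == ord0 then i else j].

Lemma pidx_incr (i j : 'I_n) : (i < j)%N ->
  [forall a : 'I_2, forall b : 'I_2, (a < b)%N ==> (pidx i j a < pidx i j b)%N].
Proof.
move=> lij; apply/forallP=> a; apply/forallP => b; apply/implyP; rewrite !ffunE.
by case: a b => [[|[|//]] ?] [[|[|//]] ?].
Qed.

Definition plucker_pair (i j : 'I_n) (lij : (i < j)%N) : plucker_index n 2 :=
  exist _ (pidx i j) (pidx_incr lij).

Lemma plucker_pair_incr (f : plucker_index n 2) : (val f ord0 < val f ord_max)%N.
Proof. by case: f => f /= /forallP/(_ ord0)/forallP/(_ ord_max). Qed.

(** A strictly increasing map from ['I_2] is the same as the pair of its two values, and [pidx] is
    the inverse correspondence. *)
Lemma sum_plucker_index (G : 'I_n -> 'I_n -> R) :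
  \sum_(f : plucker_index n 2) G (val f ord0) (val f ord_max) =
  \sum_(p : 'I_n * 'I_n | (p.1 < p.2)%N) G p.1 p.2.
Proof.
rewrite (@reindex_omap _ _ _ _ _ (fun f : plucker_index n 2 => (val f ord0, val f ord_max))
  (fun p => insub (pidx p.1 p.2))) /=; last first.
  move=> [i j] /= lij; rewrite insubT ?pidx_incr //= => h.
  by rewrite !ffunE.
apply: eq_bigl => f; rewrite plucker_pair_incr; apply/esym/eqP.
rewrite (_ : pidx _ _ = val f) ?valK //; apply/ffunP => k; rewrite ffunE.
by case: k => [[|[|//]] hk] /=; congr (sval f _); apply: val_inj.
Qed.

Lemma plucker2 (M : 'M[R]_(2, n)) (f : plucker_index n 2) :
  plucker M f = minor (row ord0 M) (row ord_max M) (val f ord0) (val f ord_max).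
Proof.
rewrite /plucker (expand_det_row _ ord0) !big_ord_recl big_ord0 /cofactor !det_mx11 !mxE /=.
rewrite /minor !mxE /=.
have -> : lift ord0 ord0 = ord_max :> 'I_2 by apply: val_inj.
have -> : lift ord_max ord0 = ord0 :> 'I_2 by apply: val_inj.
by rewrite /=; ring.
Qed.

Lemma plucker_norm (M : 'M[R]_(2, n)) :
  Num.sqrt (\sum_f plucker M f ^+ 2) = wedge_norm (row ord0 M) (row ord_max M).
Proof.
rewrite /wedge_norm -(sum_plucker_index (fun i j => minor (row ord0 M) (row ord_max M) i j ^+ 2)).
by congr Num.sqrt; apply: eq_bigr => f _; rewrite plucker2.
Qed.

End Wedge.

(** * Heights of rational planes *)

Section Height.
Variables (R : realType) (n : nat).
Implicit Types (B : {vspace 'rV[R]_n}).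

Lemma common_denominator (I : finType) (p : I -> rat) :
  exists (N : nat) (q : I -> int), (0 < N)%N /\ forall i, p i * N%:R = (q i)%:~R.
Proof.
pose N := (\prod_i `|denq (p i)|)%N.
exists N, (fun i => numq (p i) * (\prod_(j | j != i) `|denq (p j)|)%N%:Z); split.
  by rewrite prodn_gt0 // => i; rewrite absz_gt0 denq_neq0.
move=> i; rewrite /N (bigD1 i) //= natrM mulrA intrM.
rewrite numqE -[in RHS](absz_denq (p i)) //.
Qed.

Lemma primitive_scaling (I : finType) (q : I -> int) : (exists i, q i != 0) ->
  exists (g : nat) (Xi : I -> int), [/\ (0 < g)%N, forall i, q i = g%:Z * Xi i &
    \big[gcdn/0%N]_i `|Xi i|%N = 1%N].
Proof.
move=> [i0 qi0]; pose g := (\big[gcdn/0%N]_i `|q i|)%N.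
have dg i : (g %| `|q i|)%N by rewrite /g (bigD1 i) //= dvdn_gcdl.
have g0 : (0 < g)%N.
  by rewrite lt0n; apply/eqP => g0; have := dg i0; rewrite g0 dvd0n absz_eq0 (negbTE qi0).
have E i : q i = g%:Z * (q i %/ g%:Z)%Z.
  by rewrite mulrC divzK // dvdzE.
exists g, (fun i => (q i %/ g%:Z)%Z); split=> //.
apply/eqP; rewrite -(eqn_pmul2l g0) muln1.
rewrite (big_morph (muln g) (id1 := 0%N) (op1 := gcdn)) ?muln0 //; last exact: muln_gcdr.
apply/eqP/eq_bigr => i _; rewrite [in RHS](E i) abszM //.
Qed.

Lemma primitive_exists B :
  rational_subspaces 2 B -> exists Xi, primitive_plucker B (e := 2) Xi.
Proof.
move=> [M0 /basis2P].
set M := map_mx _ M0 => -[EB [i0 [j0 h0]]].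
have [N [q [N0 Hq]]] := common_denominator (fun f : plucker_index n 2 => \det (colsub (val f) M0)).
have pM f : plucker M f * N%:R = (q f)%:~R.
  by rewrite /plucker -map_mxsub det_map_mx -[N%:R in LHS](ratr_nat R) -rmorphM /= Hq ratr_int.
have [f0 qf0] : exists f, q f != 0.
  have H (i j : 'I_n) : (i < j)%N -> minor (row ord0 M) (row ord_max M) i j != 0 -> exists f, q f != 0.
    move=> lij h; exists (plucker_pair lij); rewrite -(intr_eq0 R) -pM mulf_eq0 plucker2 /= !ffunE /=.
    by rewrite negb_or h pnatr_eq0 -lt0n.
  have [lij|lji|/val_inj e] := ltngtP i0 j0.
  - exact: H lij h0.
  - by apply: H lji _; rewrite minorC oppr_eq0.
  - by move: h0; rewrite e /minor subrr eqxx.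
have [g [Xi [g0 HXi gXi]]] := primitive_scaling (ex_intro _ f0 qf0).
exists Xi; split=> //.
(* [N] clears the denominators of the minors and [g] is the gcd of the resulting integers. Scaling a
   single row by [N / g] scales every minor by that factor. *)
pose c : R := N%:R / g%:R.
have c0 : c != 0 by rewrite mulf_neq0 ?invr_eq0 ?pnatr_eq0 -?lt0n.
exists (\matrix_(i, j) ((if i == ord0 then c else 1) * M i j)).
set M' := \matrix_(i, j) _.
have r0 : row ord0 M' = c *: row ord0 M by apply/rowP => j; rewrite !mxE.
have r1 : row ord_max M' = row ord_max M by apply/rowP => j; rewrite !mxE /= mul1r.
have mM i j : minor (row ord0 M') (row ord_max M') i j = c * minor (row ord0 M) (row ord_max M) i j.
  by rewrite r0 r1 /minor !mxE; ring.
have f' : free [:: row ord0 M'; row ord_max M'].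
  by apply/free2_minor; exists i0, j0; rewrite mM mulf_neq0.
split=> [|f].
  rewrite basisEfree rows2 f' /= andbC; apply/andP; split.
    by rewrite EB; apply: leq_trans (dim_span _) _.
  apply/span_subvP => v; rewrite !inE EB => /orP[]/eqP->.
    by rewrite r0 memvZ // memv_span // inE eqxx.
  by rewrite r1 memv_span // !inE eqxx orbT.
rewrite plucker2 mM -plucker2; apply: (mulIf (x := g%:R)); first by rewrite pnatr_eq0 -lt0n.
rewrite /c mulrAC mulfVK ?pnatr_eq0 -?lt0n // mulrC pM HXi intrM mulrC //.
Qed.

(** Since a primitive vector exists, [xget] returns the norm of one, which for planes is the norm of
    the wedge product of a basis. *)
Lemma heightP B : rational_subspaces 2 B ->
  exists (M : 'M[R]_(2, n)) (Xi : plucker_index n 2 -> int),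
    [/\ basis_of B [tuple row i M | i < 2], forall f, plucker M f = (Xi f)%:~R,
        \big[gcdn/0%N]_f `|Xi f|%N = 1%N &
        height 2 B = wedge_norm (row ord0 M) (row ord_max M)].
Proof.
move=> /primitive_exists [Xi0 h0].
have [Xi [[M [bM pM]] gXi] ->] : [set h | exists2 Xi, primitive_plucker B (e := 2) Xi &
            h = Num.sqrt (\sum_f (Xi f)%:~R ^+ 2)] (height 2 B).
  by apply: xgetPex; exists (Num.sqrt (\sum_f (Xi0 f)%:~R ^+ 2)); exists Xi0.
exists M, Xi; split=> //.
by rewrite -plucker_norm; congr Num.sqrt; apply: eq_bigr => f _; rewrite pM.
Qed.

Lemma height_ge1 B : rational_subspaces 2 B -> 1 <= height 2 B.
Proof.
move=> /heightP[M [Xi [bM pM gXi ->]]].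
have [f Xf] : exists f, Xi f != 0.
  apply: contrapT => H; move: gXi; rewrite big1 // => f _; apply/eqP; rewrite absz_eq0.
  by apply: contrapT => /negP h; apply: H; exists f.
apply: le_trans (minor_wedge_le (row ord0 M) (row ord_max M) (val f ord0) (val f ord_max)).
by rewrite -plucker2 pM -intr_norm ler1z; lia.
Qed.

(* The integral Pluecker vector of any basis is a multiple of the primitive one. *)
Lemma height_integral_basis (x y : 'rV[int]_n) (i j : 'I_n) :
  let x' := map_mx intr x : 'rV[R]_n in let y' := map_mx intr y in
  minor x' y' i j != 0 ->
  rational_subspaces 2 <<[:: x'; y']>>%VS /\
  height 2 <<[:: x'; y']>>%VS <= wedge_norm x' y'.
Proof.
move=> x' y' h0; set B := <<_>>%VS.
have rB : rational_subspaces 2 B.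
  pose N : 'M[rat]_(2, n) := \matrix_(k, l) (if k == ord0 then x 0 l else y 0 l)%:~R.
  exists N; apply/basis2P.
  have -> : row ord0 (map_mx ratr N) = x'.
    by apply/rowP => k; rewrite !mxE /= ratr_int.
  have -> : row ord_max (map_mx ratr N) = y'.
    by apply/rowP => k; rewrite !mxE /= ratr_int.
  by split=> //; exists i, j.
split=> //; have [M [Xi [/basis2P[EB _] pM gXi ->]]] := heightP rB.
set r := row ord0 M in EB *; set s := row ord_max M in EB *.
have [a [b Ex]] : exists a b, x' = a *: r + b *: s.
  by apply: memv_span2; rewrite -EB memv_span // inE eqxx.
have [c [d Ey]] : exists a b, y' = a *: r + b *: s.
  by apply: memv_span2; rewrite -EB memv_span // !inE eqxx orbT.
pose k := a * d - b * c.
have mk i' j' : minor x' y' i' j' = k * minor r s i' j' by rewrite Ex Ey minor_comb.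
rewrite (wedge_norm_scale mk).
rewrite ler_peMl ?wedge_norm_ge0 //.
have k0 : k != 0 by move: h0; rewrite mk mulf_eq0 negb_or => /andP[].
pose p (f : plucker_index n 2) : int :=
  x 0 (val f ord0) * y 0 (val f ord_max) - x 0 (val f ord_max) * y 0 (val f ord0).
have pE f : (p f)%:~R = k * (Xi f)%:~R.
  by rewrite -pM plucker2 -mk /minor !mxE rmorphB !rmorphM.
have [f Xf] : exists f, Xi f != 0.
  apply: contrapT => H; move: gXi; rewrite big1 // => f _; apply/eqP; rewrite absz_eq0.
  by apply: contrapT => /negP h; apply: H; exists f.
(* As p is proportional to Xi, p_f Xi_g = Xi_f p_g, so Xi_f divides p_f Xi_g for every g. The Xi_g
   being coprime, Xi_f divides p_f, and hence |k| >= 1. *)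
have dXp : (`|Xi f| %| `|p f|)%N.
  rewrite -[`|p f|%N]muln1 -gXi (big_morph (muln `|p f|%N) (id1 := 0%N) (op1 := gcdn)) ?muln0 //; last exact: muln_gcdr.
  elim/big_ind: _ => [|u v|g _]; rewrite ?dvdn0 ?dvdn_gcd //; first by move=> -> ->.
  rewrite -abszM (_ : p f * Xi g = Xi f * p g) ?abszM ?dvdn_mulr //.
  by apply/eqP; rewrite -(eqr_int R) !intrM !pE; apply/eqP; ring.
have pf0 : p f != 0 by rewrite -(intr_eq0 R) pE mulf_neq0 // intr_eq0.
have lXp : (`|Xi f| <= `|p f|)%N by apply: dvdn_leq => //; rewrite absz_gt0.
rewrite -(ler_pM2r (x := `|(Xi f)%:~R|)); last by rewrite normr_gt0 intr_eq0.
by rewrite mul1r -normrM -pE -!intr_norm ler_int -!abszE lez_nat.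
Qed.

End Height.

(** * Box principle *)

Section Dirichlet.
Variable R : realType.

(** Truncation sorts the points into the [N ^ m] unit cells of the cube, so two of them share a
    cell. *)
Lemma pigeonhole_box (T : finType) (m N : nat) (F : 'I_m -> T -> R) :
  (forall i x, 0 <= F i x < N%:R) -> (N ^ m < #|T|)%N ->
  exists x y, x != y /\ forall i, `|F i x - F i y| < 1.
Proof.
move=> F_bnd ltN.
have Flt i x : (Num.truncn (F i x) < N)%N.
  by have /andP[F0 FN] := F_bnd i x; rewrite truncn_lt_nat.
pose cell x : {ffun 'I_m -> 'I_N} := [ffun i => Ordinal (Flt i x)].
have /injectivePn[x [y xy cxy]] : ~~ injectiveb cell.
  apply/negP => /injectiveP /leq_card; rewrite card_ffun !card_ord leqNgt ltN //.
exists x, y; split=> // i.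
have /ffunP/(_ i) := cxy; rewrite !ffunE => /(congr1 val) /= e.
have /andP[Fx0 _] := F_bnd i x; have /andP[Fy0 _] := F_bnd i y.
have := truncn_itv Fx0; have := truncn_itv Fy0; rewrite e !mulrS => /andP[h1 h2] /andP[h3 h4].
by rewrite ltr_norml; apply/andP; split; lra.
Qed.

(** Dirichlet's argument: among the points y u with 0 <= y < X, two have fractional parts in a
    common cell of side 1/T; [d] is the difference of their multipliers. *)
Lemma simultaneous_approximation (m X T : nat) (u : 'I_m -> R) :
  (0 < T)%N -> (T ^ m < X)%N ->
  exists (d : int) (z : 'I_m -> int),
    [/\ d != 0, (`|d| < X)%N & forall i, `|d%:~R * u i - (z i)%:~R| < T%:R^-1].
Proof.
move=> T0 TX; have T0' : 0 < T%:R :> R by rewrite ltr0n.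
pose fr (v : R) : R := v - (Num.floor v)%:~R.
have fr_bnd v : 0 <= fr v < 1.
  by have := floor_itv v; rewrite /fr intrD => /andP[h1 h2]; apply/andP; split; lra.
have H (i : 'I_m) (y : 'I_X) : 0 <= T%:R * fr (y%:R * u i) < T%:R.
  have /andP[h1 h2] := fr_bnd (y%:R * u i).
  by rewrite mulr_ge0 ?(ltW T0') //= gtr_pMr.
have [|a [b [ab Hab]]] := pigeonhole_box H; first by rewrite card_ord.
exists (a%:Z - b%:Z), (fun i => Num.floor (a%:R * u i) - Num.floor (b%:R * u i)); split.
- by rewrite subr_eq0.
- by have := ltn_ord a; have := ltn_ord b; lia.
move=> i; rewrite -(ltr_pM2l T0') mulfV ?gt_eqF // -[X in X * `|_|]ger0_norm ?ltW // -normrM.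
apply: le_lt_trans (Hab i); rewrite le_eqVlt; apply/orP; left; apply/eqP; congr `|_|.
by rewrite /fr !rmorphB /= -!pmulrn; ring.
Qed.

Lemma mulmx_row_bound (m p : nat) (C : 'M[R]_(m.+1, p)) : exists2 K : R, 0 < K &
  forall (x : 'rV[R]_m.+1) (b : R), (forall k, `|x 0 k| <= b) ->
    forall i, `|(x *m C) 0 i| <= K * b.
Proof.
(* The summand 1 makes the constant positive even for a zero matrix. *)
exists (1 + \sum_k \sum_i `|C k i|).
  by rewrite ltr_pwDl ?ltr01 //; do 2!(apply: sumr_ge0 => ? _).
move=> x b xb i; have b0 : 0 <= b := le_trans (normr_ge0 _) (xb ord0).
rewrite mxE; apply: le_trans (ler_norm_sum _ _ _) _.
rewrite mulrDl mul1r mulr_suml; apply: le_trans (_ : 0 + \sum_k (\sum_i `|C k i|) * b <= _); last by rewrite lerD2r.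
rewrite add0r; apply: ler_sum => k _; rewrite normrM mulrC; apply: ler_pM => //.
by rewrite (bigD1 i) //= lerDl; apply: sumr_ge0.
Qed.

Lemma dirichlet_forms (C : 'M[R]_(4, 2)) : exists2 K : R, 0 < K &
  forall Q : nat, (0 < Q)%N -> exists z : 'rV[int]_4,
    [/\ z != 0, forall k, (`|z 0%R k| <= Q)%N &
        forall i, `|(map_mx intr z *m C) 0 i| <= K / Q%:R].
Proof.
have [K K0 HK] := mulmx_row_bound C.
exists (2 * K); first by rewrite mulr_gt0.
move=> Q Q0; have Q0' : 0 < Q%:R :> R by rewrite ltr0n.
pose pt (y : {ffun 'I_4 -> 'I_Q.+1}) : 'rV[int]_4 := \row_k (y k)%:Z.
pose f y i := (map_mx intr (pt y) *m C) 0 i.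
have fb y i : `|f y i| <= K * Q%:R.
  apply: HK => k; rewrite !mxE -pmulrn ger0_norm ?ler0n // ler_nat -ltnS ltn_ord //.
(* An affine change moves the range [-KQ, KQ] onto [0, Q^2], so a unit cell stands for a difference
   of 2K/Q. There are (Q^2 + 1)^2 cells for (Q + 1)^4 points. *)
pose F i y := (f y i + K * Q%:R) * (Q%:R / (2 * K)).
have F_bnd i y : 0 <= F i y < (Q ^ 2).+1%:R.
  have := fb y i; rewrite ler_norml => /andP[h1 h2].
  have e : (K * Q%:R + K * Q%:R) * (Q%:R / (2 * K)) = (Q ^ 2)%:R.
    by rewrite natrX; field; rewrite gt_eqF.
  have q0 : 0 < Q%:R / (2 * K) by rewrite divr_gt0 // mulr_gt0.
  apply/andP; split; first by rewrite mulr_ge0 ?(ltW q0) //; lra.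
  apply: (@le_lt_trans _ _ (Q ^ 2)%:R); last by rewrite ltr_nat.
  by rewrite -e ler_wpM2r ?(ltW q0) //; lra.
have [|a [b [ab Hab]]] := pigeonhole_box F_bnd.
  rewrite card_ffun !card_ord (_ : 4 = 2 * 2)%N // expnM ltn_exp2r //; nia.
exists (pt a - pt b); split.
- apply: contraNneq ab => /subr0_eq e; apply/eqP/ffunP => k; apply: val_inj.
  by move/rowP/(_ k): e; rewrite !mxE => -[].
- by move=> k; rewrite !mxE; case: (a k) (b k) => [u hu] [v hv] /=; lia.
move=> i; rewrite map_mxB mulmxBl mxE [X in _ + X]mxE -/(f a i) -/(f b i).
have := ltW (Hab i); rewrite /F -mulrBl opprD addrACA subrr addr0 normrM.
rewrite (ger0_norm (x := _ / _)); last by rewrite divr_ge0 ?ltW // mulr_gt0.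
rewrite -ler_pdivlMr; last by rewrite divr_gt0 // mulr_gt0.
by rewrite mul1r invf_div.
Qed.

(** The largest T with T^3 < X works, since X <= (T + 1)^3 <= (2T)^3. *)
Lemma cube_root_approx (X : nat) : (1 < X)%N ->
  exists T, [/\ (0 < T)%N, (T ^ 3 < X)%N & (X <= 8 * T ^ 3)%N].
Proof.
move=> X1; have ex : exists T, (T ^ 3 < X)%N by exists 1%N.
have ub T : (T ^ 3 < X)%N -> (T <= X)%N.
  move=> h; apply: leq_trans (ltnW h); case: T h => // T _.
  by rewrite expnS leq_pmulr // expn_gt0.
case: (ex_maxnP ex ub) => T hT maxT; have T0 : (0 < T)%N by apply: maxT.
exists T; split=> //.
have : ~~ (T.+1 ^ 3 < X)%N by apply/negP => /maxT; rewrite ltnn.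
rewrite -leqNgt => /leq_trans; apply.
by rewrite (_ : 8 = 2 ^ 3)%N // -expnMn leq_exp2r //; lia.
Qed.

End Dirichlet.

(** * Integer planes close to a given plane *)

Section IntegerPlanes.
Variable R : realType.

Lemma wedge_norm_le (n : nat) (x y : 'rV[R]_n) (b : R) : 0 <= b ->
  (forall i j, `|minor x y i j| <= b) -> wedge_norm x y <= n%:R * b.
Proof.
move=> b0 H; rewrite -(ler_pXn2r (n := 2)) ?nnegrE ?wedge_norm_ge0 ?mulr_ge0 //.
rewrite wedge_norm_sqr exprMn.
apply: (@le_trans _ _ (\sum_(p : 'I_n * 'I_n) b ^+ 2)); last first.
  by rewrite sumr_const card_prod card_ord -[leLHS]mulr_natl natrM expr2.
rewrite [leRHS](bigID (fun p : 'I_n * 'I_n => (p.1 < p.2)%N)) /=.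
rewrite -[leLHS]addr0; apply: lerD; last by apply: sumr_ge0 => p _; apply: sqr_ge0.
by apply: ler_sum => p _; rewrite -real_normK ?num_real // lerXn2r ?nnegrE.
Qed.

(** The columns of [C] are linear forms. [x] is a nonzero integer point of least sup norm among
    those on which they are small, and [y] comes from approximating the ratios of its
    coordinates. *)
Lemma good_integer_basis (C : 'M[R]_(4, 2)) : exists2 K : R, 0 < K &
  forall Q : nat, (0 < Q)%N ->
  exists (x y : 'rV[int]_4) (X : nat) (i0 : 'I_4),
    let x' := map_mx intr x : 'rV[R]_4 in let y' := map_mx intr y in
    [/\ (0 < X <= Q)%N, (forall k, (`|x 0%R k| <= X)%N) /\ `|x 0%R i0|%N = X,
        forall i, `|(x' *m C) 0 i| <= K / Q%:R,
        exists i j, minor x' y' i j != 0 &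
        wedge_norm x' y' ^+ 3 <= 16 ^+ 3 * X%:R ^+ 2].
Proof.
have [K K0 HK] := dirichlet_forms C; exists K => // Q Q0.
pose P (N : nat) := exists z : 'rV[int]_4, [/\ z != 0, forall k, (`|z 0%R k| <= N)%N &
  forall i, `|(map_mx intr z *m C) 0 i| <= K / Q%:R].
have exP : exists N, `[< P N >] by exists Q; apply/asboolP; apply: HK.
case: (ex_minnP exP) => X /asboolP[x [x0 xX xC]] minX.
have X0 : (0 < X)%N.
  case: X xX {minX} => // xX; case/eqP: x0; apply/rowP => k; rewrite mxE; have := xX k.
  by rewrite leqn0 absz_eq0 => /eqP.
have XQ : (X <= Q)%N by apply: minX; apply/asboolP; apply: HK.
have [i0 xi0] : exists i0, `|x 0%R i0|%N = X.
  apply: contrapT => H; have : (X <= X.-1)%N; last by rewrite leqNgt prednK ?leqnn.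
  apply: minX; apply/asboolP; exists x; split=> // k.
  rewrite -ltnS prednK // ltn_neqAle xX andbT; apply/eqP => h; by apply: H; exists k.
pose x' := map_mx intr x : 'rV[R]_4.
have X0' : 0 < X%:R :> R by rewrite ltr0n.
have nx k : `|x' 0 k| <= X%:R.
  by rewrite mxE -intr_norm -abszE -pmulrn ler_nat.
have nx0 : `|x' 0 i0| = X%:R by rewrite mxE -intr_norm -abszE -pmulrn xi0.
have x'0 : x' 0 i0 != 0 by rewrite -normr_gt0 nx0.
(* [cube_root_approx] requires X > 1. For X = 1 a standard basis vector other than the one at [i0]
   completes [x]. *)
have [X1|X1] := leqP X 1.
  have EX : X = 1%N by apply/eqP; rewrite eqn_leq X1.
  exists x, (delta_mx 0 (lift i0 ord0)), X, i0 => x'' y'; rewrite -/x' in x'' *.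
  have ny k : `|y' 0 k| <= 1.
    by rewrite !mxE; case: (_ && _); rewrite ?normr0 ?normr1.
  split=> //; first by rewrite X0.
    exists i0, (lift i0 ord0).
    have -> : minor x'' y' i0 (lift i0 ord0) = x' 0 i0; last by [].
    rewrite /minor ![y' _ _]mxE ![delta_mx _ _ _ _]mxE !eqxx (negbTE (neq_lift _ _)) /=.
    by rewrite mulr1 mulr0 subr0.
  have : wedge_norm x'' y' <= 4%:R * 2.
    apply: wedge_norm_le => // i j; apply: le_trans (ler_normB _ _) _.
    rewrite !normrM; have := nx i; have := nx j; have := ny i; have := ny j; rewrite EX.
    move: (normr_ge0 (x' 0 i)) (normr_ge0 (x' 0 j)) (normr_ge0 (y' 0 i)) (normr_ge0 (y' 0 j)); nra.
  move=> h; apply: (@le_trans _ _ ((4%:R * 2) ^+ 3)).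
    by rewrite lerXn2r ?nnegrE ?wedge_norm_ge0 //; lra.
  rewrite EX; lra.
have [T [T0 TX XT]] := cube_root_approx X1.
have T0' : 0 < T%:R :> R by rewrite ltr0n.
(* The three ratios x_k / x_i0 are approximated with a common denominator [d], 0 < |d| < X; hence
   [y] below is close to (d / x_i0) x. *)
have [d [z [d0 dX dz]]] := simultaneous_approximation (fun i : 'I_3 => x' 0 (lift i0 i) / x' 0 i0) T0 TX.
pose y : 'rV[int]_4 := \row_k if unlift i0 k is Some i then z i else d.
pose y' := map_mx intr y : 'rV[R]_4.
have dy k : `|x' 0 i0 * y' 0 k - x' 0 k * d%:~R| <= X%:R / T%:R.
  have [i ->|->] := unliftP i0 k; last first.
    by rewrite !mxE unlift_none subrr normr0 divr_ge0 // ltW.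
  rewrite [y' _ _]mxE [y _ _]mxE liftK -nx0 distrC.
  rewrite (_ : _ - _ = x' 0 i0 * (d%:~R * (x' 0 (lift i0 i) / x' 0 i0) - (z i)%:~R)); last by field.
  by rewrite normrM ler_wpM2l // ltW // dz.
have yi0 : y 0 i0 = d by rewrite mxE unlift_none.
exists x, y, X, i0; rewrite -/x' -/y'; split=> //; first by rewrite X0.
  (* If y were parallel to x, it would equal (d / x_i0) x, which is shorter than x and has forms no
     larger, against the minimality of X. *)
  apply: contrapT => H.
  have par k : x' 0 i0 * y' 0 k = x' 0 k * d%:~R.
    have /eqP : minor x' y' i0 k = 0.
      by apply: contrapT => /eqP h; apply: H; exists i0, k.
    by rewrite /minor subr_eq0 => /eqP ->; rewrite [y' _ _]mxE yi0.
  have : (X <= `|d|)%N; last by rewrite leqNgt dX.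
  apply: minX; apply/asboolP; exists y; split.
  - by apply: contra_neq d0 => e; rewrite -yi0 e mxE.
  - move=> k; have := congr1 Num.norm (par k); rewrite !normrM nx0 => e.
    rewrite -(ler_nat R) -(ler_pM2l X0'); have := nx k.
    have -> : `|y 0%R k|%N%:R = `|y' 0 k| by rewrite [y' _ _]mxE -intr_norm -abszE -pmulrn.
    by rewrite e -[`|d%:~R|]intr_norm -abszE -pmulrn => h; rewrite ler_wpM2r.
  - move=> i; have -> : map_mx intr y = (d%:~R / x' 0 i0) *: x'.
      apply/rowP => k; rewrite [RHS]mxE mulrAC [_ * x' 0 k]mulrC -par; field.
      by [].
    rewrite -scalemxAl mxE normrM; apply: le_trans (xC i).
    rewrite ler_piMl // normrM normfV nx0 ler_pdivrMr // mul1r -intr_norm -abszE -pmulrn ler_nat.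
    exact: ltnW.
have XT0 : 0 <= X%:R / T%:R :> R by rewrite divr_ge0 ?ltW.
have : wedge_norm x' y' <= 4%:R * (2 * (X%:R / T%:R)).
  apply: wedge_norm_le => [|i j]; first by rewrite mulr_ge0.
  rewrite -(ler_pM2l X0') -nx0 -normrM.
  (* Subtracting a multiple of x from y leaves the minors unchanged, so x_i0 y can be replaced by
     x_i0 y - d x, whose coordinates are at most X / T. *)
  have -> : x' 0 i0 * minor x' y' i j = x' 0 i * (x' 0 i0 * y' 0 j - x' 0 j * d%:~R)
     - x' 0 j * (x' 0 i0 * y' 0 i - x' 0 i * d%:~R) by rewrite /minor; ring.
  apply: le_trans (ler_normB _ _) _; rewrite !normrM nx0 mulrCA mulr2n mulrDl mul1r.
  by apply: lerD; apply: ler_pM.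
move=> h; apply: (@le_trans _ _ ((4%:R * (2 * (X%:R / T%:R))) ^+ 3)).
  by rewrite lerXn2r ?nnegrE ?wedge_norm_ge0 //; lra.
(* The inequality X <= 8 T^3 turns 512 X^3 / T^3 into 512 * 8 X^2 = 16^3 X^2. *)
rewrite (_ : _ ^+ 3 = 512 * X%:R ^+ 3 / T%:R ^+ 3); last by field; rewrite gt_eqF.
rewrite ler_pdivrMr ?exprn_gt0 // exprS.
have : X%:R <= 8 * T%:R ^+ 3 :> R by rewrite -natrX -natrM ler_nat.
have : 0 < X%:R ^+ 2 :> R by rewrite exprn_gt0.
nra.
Qed.

End IntegerPlanes.

(** * The exponent is at least 3 *)

Section LowerBound.
Variable R : realType.
Implicit Types A B : {vspace 'rV[R]_4}.

(** [C] gives the coordinates of the projection onto a complement along [A], and [D] embeds them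
    back. Thus [x *m C] measures how far [x] is from [A]. *)
Lemma subspace_equations (n : nat) (A : {vspace 'rV[R]_n.+1}) :
  exists (C : 'M[R]_(n.+1, \dim A^C)) (D : 'M[R]_(\dim A^C, n.+1)),
    forall x, x - x *m C *m D \in A.
Proof.
pose p := daddv_pi A^C A.
pose C : 'M[R]_(n.+1, \dim A^C) := \matrix_(k, i) coord (vbasis A^C) i (p (delta_mx 0 k)).
pose D : 'M[R]_(\dim A^C, n.+1) := \matrix_(i, k) ((vbasis A^C)`_i : 'rV_n.+1) 0 k.
exists C, D => x.
have -> : x *m C *m D = p x.
  rewrite [RHS](coord_vbasis (memv_pi _ _ _)) mulmx_sum_row; apply: eq_bigr => i _.
  congr (_ *: _); last by apply/rowP => k; rewrite !mxE.
  rewrite mxE {2}(row_sum_delta x) !linear_sum /=; apply: eq_bigr => k _.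
  by rewrite !linearZ /= mxE.
have capAC : (A^C :&: A = 0)%VS by rewrite capvC capv_compl.
have : x \in (A^C + A)%VS by rewrite addvC addv_complf memvf.
by move/(daddv_pi_add capAC) => {1}<-; rewrite addrC addKr memv_pi.
Qed.

Lemma mulmx_rows2 (n : nat) (u : 'rV[R]_2) (M : 'M[R]_(2, n)) :
  u *m M = u 0 ord0 *: row ord0 M + u 0 ord_max *: row ord_max M.
Proof.
rewrite mulmx_sum_row !big_ord_recl big_ord0 addr0.
by rewrite (_ : lift ord0 ord0 = ord_max); last exact: val_inj.
Qed.

(** As A and B meet only in 0, the forms [C] are coordinates on B, and small values force small
    vectors. An integer point of B with such values is therefore 0. *)
Lemma form_separation A B (C : 'M[R]_(4, 2)) (D : 'M[R]_(2, 4)) :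
  (forall x, x - x *m C *m D \in A) -> rational_subspaces 2 B ->
  (\dim (A :&: B) < 1)%N ->
  exists2 kappa : R, 0 < kappa & forall v, v \in B ->
    (forall i, `|(v *m C) 0 i| <= kappa) -> forall k, `|v 0 k| < 1.
Proof.
move=> HA [M0 /basis2P]; set M := map_mx _ M0 => -[EB [i [j hij]]].
rewrite ltnS leqn0 dimv_eq0 => /eqP capAB.
(* A vector [u *m M] killed by [C] lies in both A and B, hence is 0, and the rows of [M] are
   independent. *)
have MC : M *m C \in unitmx.
  rewrite -row_free_unit; apply: inj_row_free => u uMC.
  have uMA : u *m M \in A.
    by have := HA (u *m M); rewrite -(mulmxA u M C) uMC mul0mx subr0.
  have uME := mulmx_rows2 u M.
  have uMB : u *m M \in B by rewrite EB uME mem_span2.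
  have : u *m M \in (A :&: B)%VS by rewrite memv_cap uMA.
  rewrite capAB memv0 uME => /eqP/rowP e; have := e i; have := e j.
  rewrite !mxE => ej ei; apply/rowP => k; rewrite [RHS]mxE.
  move: hij; rewrite /minor !mxE => hij.
  have u0 : u 0 ord0 = 0.
    apply: (mulIf hij); rewrite mul0r.
    set a := u 0 ord0 in ei ej *; set b := u 0 ord_max in ei ej.
    rewrite (_ : _ * _ = (a * ratr (M0 ord0 i) + b * ratr (M0 ord_max i)) * ratr (M0 ord_max j)
      - (a * ratr (M0 ord0 j) + b * ratr (M0 ord_max j)) * ratr (M0 ord_max i)); last by ring.
    by rewrite ei ej !mul0r subrr.
  have u1 : u 0 ord_max = 0.
    apply: (mulIf hij); rewrite mul0r.
    set a := u 0 ord0 in ei ej *; set b := u 0 ord_max in ei ej *.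
    rewrite (_ : _ * _ = (a * ratr (M0 ord0 j) + b * ratr (M0 ord_max j)) * ratr (M0 ord0 i)
      - (a * ratr (M0 ord0 i) + b * ratr (M0 ord_max i)) * ratr (M0 ord0 j)); last by ring.
    by rewrite ei ej !mul0r subrr.
  by case: k => [[|[|//]] hk]; [rewrite -[RHS]u0|rewrite -[RHS]u1]; congr (u _ _); apply: val_inj.
have [K K0 HK] := mulmx_row_bound (invmx (M *m C) *m M).
exists (2 * K)^-1 => [|v vB vC k]; first by rewrite invr_gt0 mulr_gt0.
have [a [b Ev]] : exists a b, v = a *: row ord0 M + b *: row ord_max M.
  by apply: memv_span2; rewrite -EB.
have [u Eu] : exists u : 'rV[R]_2, v = u *m M.
  exists (\row_l if l == ord0 then a else b).
  by rewrite mulmx_rows2 !mxE /= Ev.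
have -> : v = (v *m C) *m (invmx (M *m C) *m M).
  by rewrite {2}Eu !mulmxA -[u *m M *m C]mulmxA mulmxK.
apply: le_lt_trans (HK _ _ vC k) _.
by rewrite invfM mulrCA mulfV ?gt_eqF //; lra.
Qed.

Lemma psi_ge0 (n : nat) (x y : 'rV[R]_n) : 0 <= psi x y.
Proof. by rewrite divr_ge0 ?wedge_norm_ge0 // mulr_ge0 ?sqrtr_ge0. Qed.

Lemma psi_min_le A B x y : x \in A -> x != 0 -> y \in B -> y != 0 ->
  psi_min A B <= psi x y.
Proof.
move=> xA x0 yB y0; apply: ge_inf; last by exists x, y.
by exists 0 => _ [x' [y' [_ _ _ _ ->]]]; apply: psi_ge0.
Qed.

Lemma enorm_ge (n : nat) (x : 'rV[R]_n) k : `|x 0 k| <= enorm x.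
Proof.
rewrite -sqrtr_sqr ler_sqrt; last by apply: sumr_ge0 => p _; apply: sqr_ge0.
by rewrite (bigD1 k) //= lerDl; apply: sumr_ge0 => p _; exact: sqr_ge0.
Qed.

(** Up to sign, the minors of (a, x) are those of (x - a, x), at most 2eX, while e <= X / 2 keeps
    the norm of a at least X / 2. *)
Lemma psi_near (n : nat) (a x : 'rV[R]_n) (e X : R) (i0 : 'I_n) :
  0 < X -> e <= X / 2 -> (forall k, `|(x - a) 0 k| <= e) ->
  (forall k, `|x 0 k| <= X) -> `|x 0 i0| = X ->
  a 0 i0 != 0 /\ psi a x <= 4 * n%:R * (e / X).
Proof.
move=> X0 eX ha hx hx0.
have e0 : 0 <= e := le_trans (normr_ge0 _) (ha i0).
have ai : X / 2 <= `|a 0 i0|.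
  have := ha i0; rewrite !mxE; have := ler_normD (x 0 i0 - a 0 i0) (a 0 i0).
  by rewrite subrK hx0; lra.
split; first by rewrite -normr_gt0; lra.
have na : X / 2 <= enorm a := le_trans ai (enorm_ge a i0).
have nx : X <= enorm x by rewrite -hx0 enorm_ge.
have W : wedge_norm a x <= n%:R * (2 * (e * X)).
  apply: wedge_norm_le => [|i j]; first by rewrite !mulr_ge0 // ltW.
  have -> : minor a x i j = x 0 i * (x - a) 0 j - x 0 j * (x - a) 0 i by rewrite /minor !mxE; ring.
  apply: le_trans (ler_normB _ _) _; rewrite !normrM mulr2n mulrDl mul1r mulrC [X in _ + X]mulrC.
  by apply: lerD; apply: ler_pM.
have XX : X / 2 * X <= enorm a * enorm x.
  by apply: ler_pM => //; rewrite ?divr_ge0 // ltW.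
have XX0 : 0 < X / 2 * X by rewrite mulr_gt0 ?divr_gt0.
rewrite /psi ler_pdivrMr; last exact: lt_le_trans XX.
apply: le_trans W _; apply: le_trans (_ : 4 * n%:R * (e / X) * (X / 2 * X) <= _).
  by rewrite (_ : 4 * _ * _ * _ = n%:R * (2 * (e * X))) //; field; rewrite gt_eqF.
by rewrite ler_wpM2l // !mulr_ge0 // invr_ge0 ltW.
Qed.

(** Were there only finitely many planes for the exponent 3 - e, one [kappa] would separate them all
    from A. For large Q the plane through x is a further one, because x is a nonzero integer point
    with forms at most [kappa]. *)
Lemma mu_ge3 A : irrational_subspaces 2 2 1 A -> (3%:E <= mu A 2 1)%E.
Proof.
move=> [dimA irrA].
have [C [D HCD]] : exists (C : 'M[R]_(4, 2)) (D : 'M[R]_(2, 4)), forall x, x - x *m C *m D \in A.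
  have := subspace_equations A; rewrite dimv_compl dimA dimvf /dim /= mul1n.
  exact.
have [K K0 HK] := good_integer_basis C.
have [K' K'0 HK'] := mulmx_row_bound D.
rewrite /mu; apply/lee_subgt0Pr => e e0.
(* For e >= 3 the bound 3 - e is at most 0 and is covered by the 0 in the definition of [mu]. *)
have [e3|e3] := leP 3 e.
  by rewrite le_max; apply/orP; left; rewrite -EFinB lee_fin; lra.
rewrite le_max; apply/orP; right; apply: ereal_sup_ubound.
exists (3 - e) => //; split; first by rewrite subr_gt0.
set beta := 3 - e; move=> /finite_seqP[s Es].
have [kappa kappa0 Hk] : exists2 kappa : R, 0 < kappa & forall B, B \in s ->
    forall v, v \in B -> (forall i, `|(v *m C) 0 i| <= kappa) -> forall k, `|v 0 k| < 1.
  have rs B : B \in s -> rational_subspaces 2 B.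
    by move=> Bs; have : [set` s] B by []; rewrite -Es => -[].
  elim: s rs {Es} => [|B s IH] rs; first by exists 1.
  have [|k1 k10 H1] := IH; first by move=> B' B's; apply: rs; rewrite inE B's orbT.
  have rB : rational_subspaces 2 B by apply: rs; rewrite inE eqxx.
  have [k2 k20 H2] := form_separation HCD rB (irrA B rB).
  exists (Num.min k1 k2); first by rewrite lt_min k10.
  move=> B'; rewrite inE => /orP[/eqP->|B's] v vB vC.
    by apply: H2 => // i; apply: le_trans (vC i) _; rewrite ge_min lexx orbT.
  by apply: (H1 B') => // i; apply: le_trans (vC i) _; rewrite ge_min lexx.
(* This is the constant in psi_1(A, B) <= K2 / (QX); the factor 16 is the [4 * n] of [psi_near]. *)
pose K2 := 16 * (K' * K).
have K20 : 0 < K2 by rewrite !mulr_gt0.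
pose gam := beta / 3.
have gam0 : 0 <= gam by rewrite divr_ge0 // subr_ge0 ltW.
have gam1 : 0 < 1 - gam by rewrite subr_gt0 ltr_pdivrMr // mul1r gtrBl.
(* The first three summands make Q large enough, in order, for x to avoid the listed planes, for
   [psi_near] to apply, and for (QX)^(1 - gam) to absorb the constants. The last makes Q
   positive. *)
pose q := K / kappa + 2 * (K' * K) + (16 ^+ 3 * K2) `^ (1 - gam)^-1 + 1.
have q1 : 0 <= K / kappa by rewrite divr_ge0 ?ltW.
have q2 : 0 <= K' * K by rewrite mulr_ge0 ?ltW.
have q3 : 0 <= (16 ^+ 3 * K2) `^ (1 - gam)^-1 by rewrite powR_ge0.
have [Q Qq] : exists Q : nat, q < Q%:R.
  by exists (Num.truncn q).+1; rewrite truncnS_gt.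
have [Qkappa QK QK2 Q0'] : [/\ K / kappa <= Q%:R, 2 * (K' * K) <= Q%:R,
    (16 ^+ 3 * K2) `^ (1 - gam)^-1 <= Q%:R & 0 < Q%:R :> R].
  by move: Qq q1 q2 q3; rewrite /q; clear; split; lra.
have Q0 : (0 < Q)%N by rewrite -(ltr_nat R).
have [x [y [X [i0]]]] := HK Q Q0.
set x' := map_mx intr x; set y' := map_mx intr y; move=> /= [/andP[X0 XQ] [xX xi0] xC [i [j mij]] W].
have X0' : 1 <= X%:R :> R by rewrite ler1n.
have XQ' : X%:R <= Q%:R :> R by rewrite ler_nat.
have nx k : `|x' 0 k| <= X%:R by rewrite mxE -intr_norm -abszE -pmulrn ler_nat.
have nx0 : `|x' 0 i0| = X%:R by rewrite mxE -intr_norm -abszE -pmulrn xi0.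
have [rB hB] := height_integral_basis mij.
set B := <<_>>%VS in rB hB.
have xB : x' \in B by rewrite memv_span // inE eqxx.
have x'0 : x' != 0 by apply: contraTneq mij => ->; rewrite /minor !mxE !mul0r subrr eqxx.
have : [set` s] B; last first.
  move=> /= Bs; suff : `|x' 0 i0| < 1 by rewrite nx0 ltNge X0'.
  apply: (Hk B Bs x' xB) => l.
  by apply: le_trans (xC l) _; rewrite ler_pdivrMr // mulrC -ler_pdivrMr.
rewrite -Es; split=> //; rewrite /psi_sub /=.
pose a := x' - x' *m C *m D.
have Ha k : `|(x' - a) 0 k| <= K' * (K / Q%:R).
  by rewrite /a opprB addrC subrK; apply: HK'.
have [|a0 psia] := psi_near (lt_le_trans ltr01 X0') _ Ha nx nx0.
  rewrite mulrA ler_pdivrMr // -[X%:R / 2 * _]mulrAC ler_pdivlMr //.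
  by apply: (@le_trans _ _ Q%:R); [rewrite mulrC | rewrite ler_peMl // ltW].
have {}a0 : a != 0 by apply: contraNneq a0 => ->; rewrite mxE.
apply: le_trans (psi_min_le (HCD x') a0 xB x'0) _; apply: le_trans psia _.
have H1 := height_ge1 rB; have H0 : 0 < height 2 B := lt_le_trans ltr01 H1.
rewrite powRN -[leRHS]mul1r ler_pdivlMr ?powR_gt0 //.
have -> : beta = 3%:R * gam by rewrite /gam; field.
rewrite powRrM powR_mulrn ?(ltW H0) //.
pose Z : R := Q%:R * X%:R.
have ZQ : Q%:R <= Z by rewrite /Z ler_peMr // ltW.
have Z0 : 0 < Z := lt_le_trans Q0' ZQ.
(* H^beta is (H^3)^gam, and H^3 <= 16^3 X^2 <= 16^3 QX. *)
have h3 : (height 2 B ^+ 3) `^ gam <= (16 ^+ 3 * Z) `^ gam.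
  apply: (ge0_ler_powR gam0); rewrite ?nnegrE ?exprn_ge0 ?mulr_ge0 ?(ltW H0) ?(ltW Z0) //.
  apply: (@le_trans _ _ (wedge_norm x' y' ^+ 3)).
    by rewrite lerXn2r ?nnegrE ?wedge_norm_ge0 ?(ltW H0).
  apply: le_trans W _; rewrite ler_wpM2l // expr2 ler_wpM2r // ltW.
have hZ : 16 ^+ 3 * K2 <= (16 ^+ 3 * Z) `^ (1 - gam).
  have -> : 16 ^+ 3 * K2 = ((16 ^+ 3 * K2) `^ (1 - gam)^-1) `^ (1 - gam).
    by rewrite -powRrM mulVf ?gt_eqF // powRr1 // mulr_ge0 ?exprn_ge0 // ltW.
  apply: (ge0_ler_powR (ltW gam1)); rewrite ?nnegrE // ?mulr_ge0 ?(ltW Z0) //.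
  by apply: le_trans QK2 _; apply: le_trans ZQ _; rewrite ler_peMl ?(ltW Z0) // exprn_ege1 //; lra.
have hW : (16 ^+ 3 * Z) `^ gam * (16 ^+ 3 * Z) `^ (1 - gam) = 16 ^+ 3 * Z.
  rewrite -powRD ?subrKC ?addrC ?subrK; last by rewrite oner_eq0.
  by rewrite powRr1 // mulr_ge0 // ltW.
have : K2 * (16 ^+ 3 * Z) `^ gam <= Z.
  have c0 : 0 < 16 ^+ 3 :> R by rewrite exprn_gt0.
  rewrite -(ler_pM2l c0) -[leRHS]hW mulrA [leRHS]mulrC.
  by rewrite ler_wpM2r ?powR_ge0.
rewrite (_ : 4 * 4%:R * _ = K2 / Z); last first.
  by rewrite /K2 /Z; field; rewrite !gt_eqF // (lt_le_trans ltr01).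
move=> hK2; rewrite mulrAC ler_pdivrMr // mul1r; apply: le_trans hK2.
by rewrite ler_wpM2l // ltW.
Qed.

End LowerBound.

(** * Badly approximable points of a conic *)

(** Infinite descent at 3: c = 3c', so a^2 + b^2 = 3 c'^2, and 3 divides both a and b since -1 is
    not a square modulo 3. Dividing all three by 3 gives a smaller solution. *)
Lemma ternary_anisotropic_nat (a b c : nat) :
  (3 * (a ^ 2 + b ^ 2) = c ^ 2)%N -> [/\ a = 0, b = 0 & c = 0]%N.
Proof.
move: {2}c.+1 (ltnSn c) => n; elim: n a b c => // n IH a b c cn E.
have [c0|c0] := posnP c; first by rewrite c0 in E *; split=> //; nia.
have sq3 (x y : nat) : (3 %| x ^ 2 + y ^ 2)%N -> (3 %| x)%N /\ (3 %| y)%N.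
  rewrite /dvdn -modnDm -(modnXm 2 3 x) -(modnXm 2 3 y).
  by have := ltn_pmod x (isT : 0 < 3)%N; have := ltn_pmod y (isT : 0 < 3)%N;
    case: (x %% 3)%N => [|[|[|//]]]; case: (y %% 3)%N => [|[|[|//]]].
have : (3 %| c ^ 2)%N by rewrite -E dvdn_mulr.
rewrite Euclid_dvdX // => /andP[/dvdnP[c' Ec] _].
have [] := sq3 a b; first by apply/dvdnP; exists (c' ^ 2)%N; rewrite Ec expnMn in E; lia.
move=> /dvdnP[a' Ea] /dvdnP[b' Eb].
have [] := IH a' b' c'; first by lia.
  by rewrite Ea Eb Ec !expnMn in E; lia.
by move=> _ _ c'0; rewrite Ec c'0 in c0.
Qed.

Lemma ternary_anisotropic (a b c : int) :
  3 * (a ^+ 2 + b ^+ 2) = c ^+ 2 -> [/\ a = 0, b = 0 & c = 0].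
Proof.
move=> E; have := @ternary_anisotropic_nat `|a| `|b| `|c|; case; first by nia.
by move=> /eqP + /eqP + /eqP; rewrite !absz_eq0 => /eqP-> /eqP-> /eqP->.
Qed.

Section BadApproximation.
Variable R : realType.
Local Notation s3 := (Num.sqrt (3 : R)).

Lemma sqr_s3 : s3 ^+ 2 = 3.
Proof. by rewrite sqr_sqrtr. Qed.

(** This is (1 + t^2)(a m1 + b m2 + m3) on the circle a^2 + b^2 = 3, parametrized by a = s3 (1 -
    t^2)/(1 + t^2) and b = 2 s3 t/(1 + t^2). *)
Definition quad (m1 m2 m3 : int) (t : R) : R :=
  s3 * m1%:~R * (1 - t ^+ 2) + 2 * s3 * m2%:~R * t + m3%:~R * (1 + t ^+ 2).

(** A quarter of the discriminant of [quad] in t; [s3] enters it only through its square, whence an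
    integer. *)
Definition disc (m1 m2 m3 : int) : R :=
  (3 * (m1 ^+ 2 + m2 ^+ 2) - m3 ^+ 2)%:~R.

Definition quad_root (m1 m2 m3 : int) (tau : bool) : R :=
  ((-1) ^+ tau * Num.sqrt (disc m1 m2 m3) - s3 * m2%:~R) / (m3%:~R - s3 * m1%:~R).

(* With al, be, ga the coefficients of the quadratic polynomial, z = al t + be
   satisfies z ^ 2 = disc + al * quad; the integer disc is nonzero because the
   ternary form is anisotropic, so it is at least 1 when quad is small. *)
Lemma quad_small (m1 m2 m3 : int) (N : nat) (t d : R) :
  1 <= t <= 2 -> (0 < N)%N -> (`|m1| <= N)%N -> (`|m2| <= N)%N ->
  ~ [/\ m1 = 0, m2 = 0 & m3 = 0] ->
  7 * N%:R * d < 1 -> `|quad m1 m2 m3 t| <= d ->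
  1 <= disc m1 m2 m3 /\
  exists tau, `|t - quad_root m1 m2 m3 tau| <= d / Num.sqrt (disc m1 m2 m3).
Proof.
move=> /andP[t1 t2] N0 m1N m2N mn0 Nd qd.
have N1 : 1 <= N%:R :> R by rewrite ler1n.
have d0 : 0 <= d := le_trans (normr_ge0 _) qd.
have s0 : 0 <= s3 by apply: sqrtr_ge0.
have s2 := sqr_s3.
have s_lb : 1 <= s3 by nra.
have s_ub : s3 <= 2 by nra.
have n1 : `|m1%:~R| <= N%:R :> R by rewrite -intr_norm -abszE -pmulrn ler_nat.
have n2 : `|m2%:~R| <= N%:R :> R by rewrite -intr_norm -abszE -pmulrn ler_nat.
pose al : R := m3%:~R - s3 * m1%:~R.
pose be : R := s3 * m2%:~R.
have key : (al * t + be) ^+ 2 = disc m1 m2 m3 + al * quad m1 m2 m3 t.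
  rewrite /disc /quad /al /be !(rmorphB, rmorphM, rmorphD, rmorphXn) /=.
  by ring: s2.
(* Smallness of [quad] bounds |m3| by 5N, and s3 |m1| is at most 2N. *)
have al7 : `|al| <= 7 * N%:R.
  have h : `|m3%:~R| * (1 + t ^+ 2) <= d + 4 * N%:R * (1 + t ^+ 2).
    have -> : `|m3%:~R| * (1 + t ^+ 2) = `|quad m1 m2 m3 t - s3 * m1%:~R * (1 - t ^+ 2) - 2 * s3 * m2%:~R * t|.
      have p0 : 0 <= 1 + t ^+ 2 by rewrite addr_ge0 ?sqr_ge0.
      rewrite -{1}(ger0_norm p0) -normrM; congr `|_|.
      by rewrite /quad; ring.
    apply: le_trans (ler_normB _ _) _; apply: le_trans (lerD (ler_normB _ _) (lexx _)) _.
    rewrite -addrA; apply: lerD => //.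
    have tt : 0 <= t ^+ 2 - 1 by rewrite subr_ge0 exprn_ege1.
    have e1 : `|s3 * m1%:~R * (1 - t ^+ 2)| <= 2 * N%:R * (t ^+ 2 - 1).
      rewrite !normrM [`|1 - _|]distrC (ger0_norm s0) (ger0_norm tt).
      by apply: ler_wpM2r => //; apply: ler_pM.
    have t0 : 0 <= t by lra.
    have e2 : `|2 * s3 * m2%:~R * t| <= 4 * N%:R * t.
      rewrite !normrM (ger0_norm s0) (ger0_norm t0) (ger0_norm (x := 2)) //.
      by apply: ler_wpM2r => //; apply: ler_pM => //; rewrite ?mulr_ge0 //; lra.
    have tt2 : 2 * t <= 1 + t ^+ 2 by have := sqr_ge0 (t - 1); rewrite sqrrB; lra.
    have : N%:R * (2 * t) <= N%:R * (1 + t ^+ 2) :> R by rewrite ler_wpM2l.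
    have : 0 <= N%:R * (1 + t ^+ 2) :> R by rewrite mulr_ge0 // addr_ge0 ?sqr_ge0.
    have : 0 <= N%:R * (t ^+ 2 - 1) :> R by rewrite mulr_ge0.
    by move: e1 e2 N1; clear; lra.
  have d1 : d <= N%:R by move: Nd N1 d0; clear; nra.
  have : `|m3%:~R| <= 5 * N%:R :> R.
    have p1 : 1 <= 1 + t ^+ 2 by rewrite lerDl sqr_ge0.
    by move: h d1 p1 d0; clear; nra.
  have := ler_normB (m3%:~R : R) (s3 * m1%:~R); rewrite normrM (ger0_norm s0) -/al.
  have : s3 * `|m1%:~R| <= 2 * N%:R by apply: ler_pM.
  by clear; lra.
have alq : `|al * quad m1 m2 m3 t| < 1.
  rewrite normrM; apply: le_lt_trans Nd; exact: ler_pM.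
have D1 : 1 <= disc m1 m2 m3.
  rewrite /disc ler1z -gtz0_ge1 lt_neqAle eq_sym; apply/andP; split.
    by apply: contra_not_neq mn0 => /subr0_eq; apply: ternary_anisotropic.
  rewrite -ltzD1 -(ltr_int R) rmorphD /= -/(disc m1 m2 m3).
  have := sqr_ge0 (al * t + be); rewrite key.
  by move: alq; rewrite ltr_norml => /andP[_]; clear; lra.
split=> //.
have al0 : al != 0.
  (* If the leading coefficient vanishes, m3^2 = 3 m1^2 forces m1 = m3 = 0. Then [quad] is 2 s3 m2 t
     with m2 nonzero, larger than d allows. *)
  apply/eqP => al0; have m31 : m3%:~R = s3 * m1%:~R by apply/eqP; rewrite -subr_eq0 -/al al0.
  have [m10 _ m30] : [/\ m1 = 0, 0 = 0 :> int & m3 = 0].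
    apply: ternary_anisotropic; apply/eqP; rewrite -(eqr_int R) !(rmorphM, rmorphD, rmorphXn) /= m31.
    by rewrite -[eqbRHS]expr2 exprMn s2; apply/eqP; ring.
  have m20 : 1 <= `|m2%:~R| :> R.
    by rewrite -intr_norm ler1z -gtz0_ge1 normr_gt0; apply: contra_not_neq mn0.
  move: qd; rewrite /quad m10 m30 mulr0 !mul0r add0r addr0 !normrM (ger0_norm s0).
  rewrite (ger0_norm (le_trans ler01 t1)) (ger0_norm (x := 2)) //.
  have e1 : 1 <= s3 * `|m2%:~R| by rewrite -[leLHS]mulr1; apply: ler_pM.
  have : 1 <= s3 * `|m2%:~R| * t by rewrite -[leLHS]mulr1; apply: ler_pM.
  by move: Nd N1 d0; clear; nra.
have sD0 : 0 < Num.sqrt (disc m1 m2 m3) by rewrite sqrtr_gt0; lra.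
have sD2 : Num.sqrt (disc m1 m2 m3) ^+ 2 = disc m1 m2 m3 by rewrite sqr_sqrtr //; lra.
set r := Num.sqrt _ in sD0 sD2 *; set z := al * t + be in key.
have fact : (z - r) * (z + r) = al * quad m1 m2 m3 t by rewrite -subr_sqr key sD2 addrC addKr.
have rootE tau : t - quad_root m1 m2 m3 tau = (z - (-1) ^+ tau * r) / al.
  by rewrite /quad_root -/r -/al -/be /z; field.
have close u v : u * v = al * quad m1 m2 m3 t -> r <= `|v| -> `|u / al| <= d / r.
  move=> uv rv; rewrite normrM normfV ler_pdivrMr ?normr_gt0 // mulrAC ler_pdivlMr //.
  apply: (@le_trans _ _ `|u * v|); first by rewrite normrM ler_wpM2l.
  by rewrite uv normrM mulrC ler_wpM2r.
(* Of z - r and z + r, the one in which the absolute values add up is at least r in size. The other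
   is then small, and it is al times the difference between t and a root. *)
have [z0|z0] := leP 0 z.
  exists false; rewrite rootE mul1r; apply: close fact _.
  by rewrite ger0_norm; lra.
exists true; rewrite rootE expr1 mulN1r opprK; apply: (close _ (z - r)).
  by rewrite mulrC.
by rewrite ltr0_norm; lra.
Qed.

(** Telescoping, by 1 / sqrt(n + 1) <= 2 (sqrt(n + 1) - sqrt n). *)
Lemma sum_inv_sqrt (n : nat) :
  \sum_(l < n) (Num.sqrt (l.+1%:R : R))^-1 <= 2 * Num.sqrt n%:R.
Proof.
elim: n => [|n IH]; first by rewrite big_ord0 mulr_ge0 ?sqrtr_ge0.
rewrite big_ord_recr /=; apply: le_trans (lerD IH (lexx _)) _.
have s0 : 0 < Num.sqrt (n.+1%:R : R) by rewrite sqrtr_gt0 ltr0n.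
have s2 : Num.sqrt (n.+1%:R : R) ^+ 2 = n%:R + 1 by rewrite sqr_sqrtr // mulrS addrC.
have u2 : Num.sqrt (n%:R : R) ^+ 2 = n%:R by rewrite sqr_sqrtr.
set s := Num.sqrt _ in s0 s2 *; set u := Num.sqrt _ in u2 *.
rewrite -lerBrDl -mulrBr -[leLHS]mul1r ler_pdivrMr //.
by have := sqr_ge0 (s - u); rewrite sqrrB; move: s2 u2; clear; lra.
Qed.

(** Counting down from the largest index k, the first term is at most 1, and the term l + 1 places
    below it is at most 1 / sqrt((l + 1) k); these sum to at most 2. The bound is uniform in F. *)
Lemma sum_inv_sqrt_disc (F K : nat) : (forall k, (k < K)%N -> (k ^ 2 < F)%N) ->
  \sum_(k < K) (Num.sqrt (F%:R - k%:R ^+ 2 : R))^-1 <= 3.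
Proof.
case: K => [|K] KF; first by rewrite big_ord0.
rewrite (reindex_inj rev_ord_inj) big_ord_recl /= subn1 /=.
have KF' : K%:R ^+ 2 + 1 <= F%:R :> R by rewrite -natrX natr1 ler_nat KF.
have inv_le (a b : R) : 0 < a -> a <= b -> (Num.sqrt b)^-1 <= (Num.sqrt a)^-1.
  move=> a0 ab; rewrite lef_pV2 ?posrE ?sqrtr_gt0 ?(lt_le_trans a0) //.
  by rewrite ler_sqrt // (le_trans (ltW a0)).
have -> : 3 = 1 + 2 :> R by lra.
apply: lerD.
  have := inv_le 1 (F%:R - K%:R ^+ 2) ltr01; rewrite sqrtr1 invr1; apply; lra.
have [->|K0] := posnP K; first by rewrite big_ord0.
have K0' : 0 < Num.sqrt (K%:R : R) by rewrite sqrtr_gt0 ltr0n.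
apply: (@le_trans _ _ (\sum_(l < K) (Num.sqrt (l.+1%:R : R))^-1 / Num.sqrt K%:R)).
  apply: ler_sum => l _; rewrite -invfM -sqrtrM //.
  apply: inv_le; first by rewrite mulr_gt0 // ltr0n.
  have lK := ltn_ord l; rewrite /bump /= add1n subSS natrB; last by lia.
  have : l.+1%:R <= K%:R :> R by rewrite ler_nat.
  by move: KF' (ler0n R l.+1); clear; rewrite mulrS; nra.
rewrite -mulr_suml ler_pdivrMr // sum_inv_sqrt //.
Qed.

End BadApproximation.

(** * Measure of the excluded parameters *)

Section Covering.
Variable R : realType.
Local Notation mu := (@lebesgue_measure R).

Definition balls (s : seq (R * R)) : set R :=
  [set t | exists2 p, p \in s & `|t - p.1| <= p.2].

Lemma balls_nil : balls [::] = set0.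
Proof. by apply/seteqP; split=> t // -[]. Qed.

Lemma balls_cons p s : balls (p :: s) = `[p.1 - p.2, p.1 + p.2]%classic `|` balls s.
Proof.
apply/seteqP; split=> t /=; rewrite in_itv /= -ler_distl.
  by case=> q; rewrite inE => /orP[/eqP->|qs] h; [left|right; exists q].
case=> [h|[q qs h]]; first by exists p; rewrite ?inE ?eqxx.
by exists q; rewrite // inE qs orbT.
Qed.

Lemma measurable_balls s : measurable (balls s).
Proof.
elim: s => [|p s IH]; first by rewrite balls_nil; exact: measurable0.
by rewrite balls_cons; apply: measurableU.
Qed.

Lemma balls_measure s : {in s, forall p, 0 <= p.2} ->
  (mu (balls s) <= (2 * \sum_(p <- s) p.2)%:E)%E.
Proof.
elim: s => [|p s IH] s0; first by rewrite balls_nil measure0 big_nil mulr0.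
have p0 : 0 <= p.2 by apply: s0; rewrite inE eqxx.
rewrite balls_cons big_cons mulrDr EFinD.
have mp : measurable `[p.1 - p.2, p.1 + p.2]%classic by exact: measurable_itv.
apply: le_trans (measureU2 mu mp (measurable_balls s)) _.
have mu_p : (mu `[(p.1 - p.2)%R, (p.1 + p.2)%R]%classic <= (2 * p.2)%:E)%E.
  rewrite lebesgue_measure_itv /=; case: ifP => _; last by rewrite lee_fin mulr_ge0.
  by rewrite -EFinB lee_fin; lra.
apply: (leeD mu_p); apply: IH => q qs; apply: s0; by rewrite inE qs orbT.
Qed.

(** The interval [1, 2] is longer than all the balls together, so countable subadditivity leaves a
    point uncovered. *)
Lemma uncovered_point (s : nat -> seq (R * R)) (c : R) :
  (forall k, {in s k, forall p, 0 <= p.2}) ->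
  (forall n, \sum_(k < n) 2 * (\sum_(p <- s k) p.2) <= c) -> c < 1 ->
  exists t, 1 <= t <= 2 /\ forall k, ~ balls (s k) t.
Proof.
move=> s0 sc c1; apply: contrapT => H.
have cov : `[1, 2]%classic `<=` \bigcup_k balls (s k).
  move=> t /=; rewrite in_itv /= => t12; apply: contrapT => nt; apply: H; exists t.
  by split=> // k st; apply: nt; exists k.
have mu12 : mu `[1, 2]%classic = 1%:E.
  by rewrite lebesgue_measure_itv /= lte_fin ltr1n /= -EFinB; congr EFin; lra.
have := measure_sigma_subadditive mu (fun k => measurable_balls (s k)) (measurable_itv _) cov.
apply/negP; rewrite -ltNge; apply: (@le_lt_trans _ _ c%:E); last by rewrite [ltRHS]mu12 lte_fin.
apply: lime_le.
  by apply: is_cvg_nneseries => k _ _; apply: measure_ge0.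
apply: nearW => n; rewrite big_mkord.
apply: (@le_trans _ _ (\sum_(k < n) 2 * \sum_(p <- s k) p.2)%:E); last by rewrite lee_fin.
by rewrite -sumEFin; apply: lee_sum => k _; apply: balls_measure.
Qed.

(** The four entries are the two signs of m3, of absolute value [k], with two roots each. For F = 3
    (m1^2 + m2^2) the number F - k^2 is [disc]. *)
Definition near_roots (F : nat) (m1 m2 : int) (d : R) (k : nat) : seq (R * R) :=
  [seq (quad_root R m1 m2 ((-1) ^+ nat_of_bool st.1 * k%:Z) st.2, d / Num.sqrt (F%:R - k%:R ^+ 2))
     | st <- [:: (false, false); (false, true); (true, false); (true, true)]].

Lemma isqrt_exists (F : nat) : exists K, forall k, (k < K)%N = (k ^ 2 < F)%N.
Proof.
have ex : exists K, (F <= K ^ 2)%N by exists F; case: F => // F; rewrite leq_pmulr.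
case: (ex_minnP ex) => K FK minK; exists K => k; apply/idP/idP => h.
  by rewrite ltnNge; apply/negP => /minK; rewrite leqNgt h.
by rewrite -(ltn_exp2r _ _ (e := 2)) // (leq_trans h).
Qed.

(** Smallness of [quad] forces disc >= 1, so m3^2 < F. Four roots for each |m3| and
    [sum_inv_sqrt_disc] give a total of 4 * 3 d, however large m1 and m2 are. *)
Lemma bad_pair (N : nat) (d : R) (m1 m2 : int) :
  (0 < N)%N -> 0 <= d -> 7 * N%:R * d < 1 -> (`|m1| <= N)%N -> (`|m2| <= N)%N ->
  exists s : seq (R * R), [/\ {in s, forall p, 0 <= p.2}, \sum_(p <- s) p.2 <= 12 * d &
    forall t m3, 1 <= t <= 2 -> ~ [/\ m1 = 0, m2 = 0 & m3 = 0] ->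
      `|quad m1 m2 m3 t| <= d -> balls s t].
Proof.
move=> N0 d0 Nd m1N m2N; pose F := (3 * (`|m1| ^ 2 + `|m2| ^ 2))%N.
have [K HK] := isqrt_exists F.
exists (flatten [seq near_roots F m1 m2 d k | k <- iota 0 K]); split.
- by move=> p /flatten_mapP[k _ /mapP[st _ ->]]; rewrite divr_ge0 ?sqrtr_ge0.
- rewrite big_flatten big_map (_ : iota 0 K = index_iota 0 K) ?/index_iota ?subn0 // -{1}[K]subn0 big_mkord.
  rewrite (eq_bigr (fun k : 'I_K => 4 * d * (Num.sqrt (F%:R - k%:R ^+ 2 : R))^-1)); last first.
    by move=> k _; rewrite !big_cons big_nil /=; ring.
  rewrite -mulr_sumr (_ : 12 * d = 4 * d * 3); last by ring.
  rewrite ler_wpM2l ?mulr_ge0 //; apply: sum_inv_sqrt_disc => k; by rewrite HK.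
move=> t m3 t12 mn0 qd; have [D1 [tau Htau]] := quad_small t12 N0 m1N m2N mn0 Nd qd.
have DE : disc R m1 m2 m3 = F%:R - `|m3|%N%:R ^+ 2.
  rewrite /disc /F natrM natrD !natrX !(rmorphB, rmorphM, rmorphD, rmorphXn) /=.
  have sq (m : int) : (`|m|%N%:R : R) ^+ 2 = m%:~R ^+ 2.
    by rewrite pmulrn abszE intr_norm real_normK ?num_real.
  by rewrite !sq; ring.
have kK : (`|m3| < K)%N.
  by rewrite HK -(ltr_nat R) natrX -subr_gt0 -DE; lra.
exists (quad_root R m1 m2 m3 tau, d / Num.sqrt (disc R m1 m2 m3)).
  apply/flatten_mapP; exists `|m3|%N; first by rewrite mem_iota add0n.
  apply/mapP; exists (m3 < 0, tau); last by rewrite DE /= -intEsign.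
  by case: (m3 < 0); case: tau {Htau}.
by [].
Qed.

(** There are (2N + 1)^2 <= 9 N^2 pairs (m1, m2), each at a cost of 12 d. *)
Lemma bad_square (N : nat) (d : R) : (0 < N)%N -> 0 <= d -> 7 * N%:R * d < 1 ->
  exists s : seq (R * R), [/\ {in s, forall p, 0 <= p.2},
    \sum_(p <- s) p.2 <= 108 * (N%:R ^+ 2 * d) &
    forall t m1 m2 m3, 1 <= t <= 2 -> (`|m1| <= N)%N -> (`|m2| <= N)%N ->
      ~ [/\ m1 = 0, m2 = 0 & m3 = 0] -> `|quad m1 m2 m3 t| <= d -> balls s t].
Proof.
move=> N0 d0 Nd; pose I : finType := 'I_(2 * N).+1.
pose co (i : I) : int := i%:Z - N%:Z.
have coN i : (`|co i| <= N)%N by rewrite /co; have := ltn_ord i; lia.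
have [f Hf] := choice (fun ij : I * I => bad_pair N0 d0 Nd (coN ij.1) (coN ij.2)).
exists (flatten [seq f ij | ij <- enum {: I * I}]); split.
- move=> p /flatten_mapP[ij _ pf]; have [h _ _] := Hf ij; exact: h.
- rewrite big_flatten big_map big_enum /=.
  apply: (@le_trans _ _ (\sum_(ij : I * I) 12 * d)).
    by apply: ler_sum => ij _; have [] := Hf ij.
  rewrite sumr_const card_prod !card_ord -[leLHS]mulr_natr natrM -[(2 * N).+1%:R]natr1 natrM.
  have N1 : 1 <= N%:R :> R by rewrite ler1n.
  have : (2%:R * N%:R + 1) * (2%:R * N%:R + 1) <= 9 * N%:R ^+ 2 :> R by nra.
  by move=> /(ler_wpM2l (mulr_ge0 _ d0)) => /(_ 12 (ler0n _ 12)); clear; lra.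
move=> t m1 m2 m3 t12 m1N m2N mn0 qd.
have idx (m : int) : (`|m| <= N)%N -> exists i, co i = m.
  move=> mN; have h : (`|(m + N%:Z)%R| < (2 * N).+1)%N by lia.
  by exists (Ordinal h); rewrite /co /=; lia.
have [i Ei] := idx _ m1N; have [j Ej] := idx _ m2N.
have [_ _ H] := Hf (i, j); rewrite /= Ei Ej in H.
have [p pf pt] := H t m3 t12 mn0 qd; exists p => //.
by apply/flatten_mapP; exists (i, j) => //; rewrite mem_enum.
Qed.

(** Dyadic Borel-Cantelli: the set excluded at level N = 2^k has measure at most 216 N^2 d = 216 kap
    q^k, the term of a geometric series. *)
Lemma badly_approximable_point (eps : R) : 0 < eps ->
  exists (t c : R), [/\ 1 <= t <= 2, 0 < c &
    forall (N : nat) (m1 m2 m3 : int), (0 < N)%N -> (`|m1| <= N)%N -> (`|m2| <= N)%N ->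
      ~ [/\ m1 = 0, m2 = 0 & m3 = 0] ->
      c * N%:R `^ (- (2 + eps)) <= `|quad m1 m2 m3 t|].
Proof.
move=> eps0; pose q : R := 2 `^ (- eps).
have q0 : 0 < q by rewrite powR_gt0.
have q1 : q < 1.
  have h : 1 < 2 `^ eps :> R.
    have e1 : 1 `^ eps = 1 :> R by rewrite powR1.
    by rewrite -[ltLHS]e1; apply: gt0_ltr_powR; rewrite ?nnegrE // ltr1n.
  by rewrite /q powRN invf_lt1 // powR_gt0.
(* With this choice the total length is at most 216 kap / (1 - q) = 216/250 < 1, and 7 kap < 1 as
   [bad_square] requires. *)
pose kap := (1 - q) / 250.
have kap0 : 0 < kap by rewrite /kap; move: q1; clear; lra.
have kap1 : 7 * kap < 1 by rewrite /kap; move: q0; clear; lra.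
pose dl (k : nat) : R := kap * (2 ^ k)%:R `^ (- (2 + eps)).
have dl0 k : 0 <= dl k by rewrite mulr_ge0 ?powR_ge0 // ltW.
have dlE k : (2 ^ k)%:R ^+ 2 * dl k = kap * q ^+ k.
  have e2 : (2 ^ k)%:R = 2 `^ k%:R :> R by rewrite natrX powR_mulrn.
  have p0 : 0 < 2 `^ k%:R :> R by rewrite powR_gt0.
  rewrite /dl mulrCA e2; congr (_ * _).
  rewrite -(powR_mulrn 2 (ltW p0)) -powRD; last by rewrite (gt_eqF p0) implybT.
  have -> : 2%:R + - (2 + eps) = - eps by ring.
  by rewrite -(powR_mulrn k (ltW q0)) /q -!powRrM mulrC.
have small k : 7 * (2 ^ k)%:R * dl k < 1.
  have p1 : 1 <= (2 ^ k)%:R :> R by rewrite ler1n expn_gt0.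
  have : (2 ^ k)%:R * dl k <= (2 ^ k)%:R ^+ 2 * dl k.
    by rewrite ler_wpM2r // expr2 ler_peMl // ler0n.
  rewrite dlE; have : kap * q ^+ k <= kap.
    by rewrite ler_piMr ?(ltW kap0) // exprn_ile1 ?(ltW q0) ?(ltW q1).
  by move: kap1; clear; lra.
have gt02 k : (0 < 2 ^ k)%N by rewrite expn_gt0.
have [s Hs] := choice (fun k => bad_square (gt02 k) (dl0 k) (small k)).
have [| | |] := @uncovered_point s (216 / 250).
- by move=> k; have [] := Hs k.
- move=> n; apply: (@le_trans _ _ (\sum_(k < n) 216 * (kap * q ^+ k))).
    apply: ler_sum => k _; have [_ h _] := Hs k; move: h; rewrite dlE; clear; lra.
  rewrite -mulr_sumr -mulr_sumr.
  have geo : (1 - q) * \sum_(k < n) q ^+ k = 1 - q ^+ n.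
    by rewrite -[RHS]opprB subrX1 -mulNr opprB.
  have : (1 - q) * \sum_(k < n) q ^+ k <= 1 by rewrite geo gerBl exprn_ge0 // ltW.
  by rewrite /kap; set S := \sum_(k < n) _; clear; lra.
- by lra.
move=> t [t12 Ht]; exists t, (kap * 2 `^ (- (2 + eps))); split=> //.
  by rewrite mulr_gt0 // powR_gt0.
move=> N m1 m2 m3 N0 m1N m2N mn0.
(* Since N <= 2^k <= 2N, rounding up to a power of 2 costs only the factor 2^-(2 + eps) in the
   constant. *)
pose k := up_log 2 N.
have Nk : (N <= 2 ^ k)%N by apply: up_logP.
have kN : (2 ^ k <= 2 * N)%N.
  have [N1|N1] := leqP N 1.
    have N1' : N = 1%N by lia.
    by rewrite /k N1' up_log1.
  have /andP[h _] := up_log_bounds (isT : 1 < 2)%N N1.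
  have k0 : (0 < k)%N by rewrite up_log_gt0.
  by rewrite -(prednK k0) expnS leq_pmul2l // ltnW.
rewrite leNgt; apply/negP => qs; apply: (Ht k).
have [_ _ H] := Hs k; apply: (H t m1 m2 m3) => //; [exact: leq_trans Nk|exact: leq_trans Nk|].
apply: ltW; apply: lt_le_trans qs _.
rewrite /dl -mulrA ler_wpM2l ?(ltW kap0) // -powRM //.
rewrite !powRN lef_pV2 ?posrE ?powR_gt0 ?ltr0n ?mulr_gt0 ?ltr0n //.
by apply: ge0_ler_powR; rewrite ?nnegrE ?addr_ge0 ?(ltW eps0) // -natrM ler_nat.
Qed.

End Covering.

(** * Angles with the example plane *)

Local Notation i0 := (@Ordinal 4 0 isT).
Local Notation i1 := (@Ordinal 4 1 isT).
Local Notation i2 := (@Ordinal 4 2 isT).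
Local Notation i3 := (@Ordinal 4 3 isT).

Section ExamplePlane.
Variable R : realType.
Implicit Types x y r s : 'rV[R]_4.

Lemma sum4 (F : 'I_4 -> R) : \sum_i F i = F i0 + F i1 + F i2 + F i3.
Proof.
rewrite !big_ord_recl big_ord0 addr0 !addrA.
by congr (_ + _ + _ + _); congr F; apply: val_inj.
Qed.

Lemma wedge_norm4 x y : wedge_norm x y ^+ 2 =
  minor x y i0 i1 ^+ 2 + minor x y i0 i2 ^+ 2 + minor x y i0 i3 ^+ 2 +
  minor x y i1 i2 ^+ 2 + minor x y i1 i3 ^+ 2 + minor x y i2 i3 ^+ 2.
Proof.
rewrite wedge_norm_sqr big_mkcond.
rewrite -(pair_bigA _ (fun i j : 'I_4 => if (i < j)%N then minor x y i j ^+ 2 else 0)) /=.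
by rewrite sum4 !sum4 /=; ring.
Qed.

Lemma enorm4 x : enorm x ^+ 2 = x 0 i0 ^+ 2 + x 0 i1 ^+ 2 + x 0 i2 ^+ 2 + x 0 i3 ^+ 2.
Proof. by rewrite sqr_sqrtr ?sum4 // addr_ge0 ?sqr_ge0 // addr_ge0 ?sqr_ge0 // addr_ge0 ?sqr_ge0. Qed.

Definition dot x y : R := \sum_i x 0 i * y 0 i.

Lemma lagrange4 x y : wedge_norm x y ^+ 2 = enorm x ^+ 2 * enorm y ^+ 2 - dot x y ^+ 2.
Proof. by rewrite wedge_norm4 !enorm4 /dot sum4 /minor; ring. Qed.

Lemma enorm_gt0 x : x != 0 -> 0 < enorm x.
Proof.
move=> x0; rewrite lt_neqAle sqrtr_ge0 andbT; apply: contraNneq x0 => e.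
have nx k : x 0 k = 0.
  by apply/eqP; rewrite -normr_le0 [leRHS]e enorm_ge.
by apply/eqP/rowP => k; rewrite nx mxE.
Qed.

(** The vector [z] completes y to a basis with the same minors as (r, s); removing its component
    along y makes it orthogonal to y and changes no minor. *)
Lemma orthogonal_basis_change r s y : y \in <<[:: r; s]>>%VS -> y != 0 ->
  exists y', dot y y' = 0 /\ forall i j, minor y y' i j = minor r s i j.
Proof.
move=> /memv_span2[c [d Ey]] y0.
have cd : c ^+ 2 + d ^+ 2 != 0.
  rewrite paddr_eq0 ?sqr_ge0 // !sqrf_eq0; apply: contra y0 => /andP[/eqP c0 /eqP d0].
  by rewrite Ey c0 d0 !scale0r addr0.
have yy : dot y y != 0.
  have -> : dot y y = enorm y ^+ 2 by rewrite enorm4 /dot sum4; ring.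
  by rewrite sqrf_eq0 gt_eqF // enorm_gt0.
pose z := (- d / (c ^+ 2 + d ^+ 2)) *: r + (c / (c ^+ 2 + d ^+ 2)) *: s.
exists (z - (dot y z / dot y y) *: y); split.
  have dotB w w' (k : R) : dot y (w - k *: w') = dot y w - k * dot y w'.
    by rewrite /dot !sum4 !mxE; ring.
  by rewrite dotB divfK // subrr.
move=> i j; have -> : minor y (z - (dot y z / dot y y) *: y) i j = minor y z i j.
  by rewrite /minor !mxE; ring.
rewrite Ey minor_comb (_ : _ - _ = 1) ?mul1r //; by field.
Qed.

(** Lagrange's identity writes the difference as a sum of 15 squares. *)
Lemma cauchy_schwarz6 (p1 p2 p3 p4 p5 p6 q1 q2 q3 q4 q5 q6 : R) :
  (p1 * q1 + p2 * q2 + p3 * q3 + p4 * q4 + p5 * q5 + p6 * q6) ^+ 2 <=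
  (p1 ^+ 2 + p2 ^+ 2 + p3 ^+ 2 + p4 ^+ 2 + p5 ^+ 2 + p6 ^+ 2) *
  (q1 ^+ 2 + q2 ^+ 2 + q3 ^+ 2 + q4 ^+ 2 + q5 ^+ 2 + q6 ^+ 2).
Proof.
rewrite -subr_ge0.
rewrite (_ : _ - _ = (p1 * q2 - p2 * q1) ^+ 2 + (p1 * q3 - p3 * q1) ^+ 2
  + (p1 * q4 - p4 * q1) ^+ 2 + (p1 * q5 - p5 * q1) ^+ 2 + (p1 * q6 - p6 * q1) ^+ 2
  + (p2 * q3 - p3 * q2) ^+ 2 + (p2 * q4 - p4 * q2) ^+ 2 + (p2 * q5 - p5 * q2) ^+ 2
  + (p2 * q6 - p6 * q2) ^+ 2 + (p3 * q4 - p4 * q3) ^+ 2 + (p3 * q5 - p5 * q3) ^+ 2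
  + (p3 * q6 - p6 * q3) ^+ 2 + (p4 * q5 - p5 * q4) ^+ 2 + (p4 * q6 - p6 * q4) ^+ 2
  + (p5 * q6 - p6 * q5) ^+ 2); last by ring.
by rewrite !addr_ge0 ?sqr_ge0.
Qed.

(** For a^2 + b^2 = 3 the vectors u and v are orthogonal of norm 2, and their minors are (a, b, 1,
    -3, -b, a). *)
Definition plane_u (a b : R) : 'rV[R]_4 := \row_k [:: 1; - b; a; 0]`_k.
Definition plane_v (a b : R) : 'rV[R]_4 := \row_k [:: 0; a; b; 1]`_k.

(* det (u, v, r, s), for u and v the above basis and a ^ 2 + b ^ 2 = 3. *)
Definition plane_form (a b : R) r s : R :=
  a * (minor r s i0 i1 + minor r s i2 i3) + b * (minor r s i0 i2 - minor r s i1 i3)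
  + (minor r s i1 i2 - 3 * minor r s i0 i3).

(* With x' and y' completing x and y to orthogonal bases of the two planes,
   det (x, x', y, y') is at most |x /\ y| |x'| |y'| by Cauchy-Schwarz. *)
Lemma psi_ge_plane_form (a b : R) x y r s :
  a ^+ 2 + b ^+ 2 = 3 ->
  x \in <<[:: plane_u a b; plane_v a b]>>%VS -> x != 0 ->
  y \in <<[:: r; s]>>%VS -> y != 0 ->
  `|plane_form a b r s| <= 4 * wedge_norm r s * psi x y.
Proof.
move=> ab /memv_span2[al [be Ex]] x0 yB y0.
have [y' [yy' my']] := orthogonal_basis_change yB y0.
pose k := al ^+ 2 + be ^+ 2.
(* This is x turned by a right angle in its plane; the minors of (x, x') are k times those of (u,
   v). *)
pose x' := (- be) *: plane_u a b + al *: plane_v a b.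
have xk : enorm x ^+ 2 = 4 * k.
  rewrite enorm4 Ex !mxE /= /k; transitivity ((al ^+ 2 + be ^+ 2) * (a ^+ 2 + b ^+ 2 + 1)); first by ring.
  by rewrite ab; ring.
have x'k : enorm x' ^+ 2 = 4 * k.
  rewrite enorm4 !mxE /= /k; transitivity ((al ^+ 2 + be ^+ 2) * (a ^+ 2 + b ^+ 2 + 1)); first by ring.
  by rewrite ab; ring.
have nx := enorm_gt0 x0; have ny := enorm_gt0 y0.
have k0 : 0 < k by have : 0 < enorm x ^+ 2 by [rewrite exprn_gt0]; rewrite xk; lra.
have Ly : plane_form a b r s = plane_form a b y y' by rewrite /plane_form !my'.
have HL : wedge_norm r s ^+ 2 = enorm y ^+ 2 * enorm y' ^+ 2.
  by have := lagrange4 y y'; rewrite yy' expr0n subr0 => <-; rewrite !wedge_norm4 !my'.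
(* The left side is the Laplace expansion of det (x, y, x', y') along its first two rows, and
   exchanging y and x' gives the sign. *)
have E : minor x y i0 i1 * minor x' y' i2 i3 + minor x y i0 i2 * (- minor x' y' i1 i3)
  + minor x y i0 i3 * minor x' y' i1 i2 + minor x y i1 i2 * minor x' y' i0 i3
  + minor x y i1 i3 * (- minor x' y' i0 i2) + minor x y i2 i3 * minor x' y' i0 i1
  = - (k * plane_form a b r s).
  have ab2 : a ^+ 2 = 3 - b ^+ 2 by rewrite -ab addrK.
  by rewrite Ly /plane_form /minor Ex /x' !mxE /= /k; ring: ab2.
have := cauchy_schwarz6 (minor x y i0 i1) (minor x y i0 i2) (minor x y i0 i3) (minor x y i1 i2)
  (minor x y i1 i3) (minor x y i2 i3) (minor x' y' i2 i3) (- minor x' y' i1 i3) (minor x' y' i1 i2)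
  (minor x' y' i0 i3) (- minor x' y' i0 i2) (minor x' y' i0 i1).
rewrite E -wedge_norm4 !sqrrN exprMn => CS.
have W' : wedge_norm x' y' ^+ 2 <= 4 * k * enorm y' ^+ 2.
  by rewrite lagrange4 x'k gerBl sqr_ge0.
have {}CS : k ^+ 2 * plane_form a b r s ^+ 2 <= wedge_norm x y ^+ 2 * (4 * k * enorm y' ^+ 2).
  apply: le_trans CS _; rewrite ler_wpM2l ?sqr_ge0 //; apply: le_trans W'.
  rewrite wedge_norm4 le_eqVlt; apply/orP; left; apply/eqP; ring.
have : (plane_form a b r s * (enorm x * enorm y)) ^+ 2 <= (4 * wedge_norm r s * wedge_norm x y) ^+ 2.
  rewrite !exprMn xk HL.
  have : 16 * k^-1 * enorm y ^+ 2 * (k ^+ 2 * plane_form a b r s ^+ 2) <=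
     16 * k^-1 * enorm y ^+ 2 * (wedge_norm x y ^+ 2 * (4 * k * enorm y' ^+ 2)).
    apply: ler_wpM2l => //; apply: mulr_ge0 (sqr_ge0 _); apply: mulr_ge0 => //.
    by rewrite invr_ge0 ltW.
  rewrite (_ : 16 * k^-1 * _ * (k ^+ 2 * _) = 16 * (k * enorm y ^+ 2 * plane_form a b r s ^+ 2)); last first.
    by field; rewrite gt_eqF.
  rewrite (_ : 16 * k^-1 * _ * _ = 16 * (4 * (wedge_norm x y ^+ 2 * (enorm y ^+ 2 * enorm y' ^+ 2)))); last first.
    by field; rewrite gt_eqF.
  by clear; lra.
move=> sq_le; rewrite /psi mulrA ler_pdivlMr ?mulr_gt0 // -ler_sqr ?nnegrE ?mulr_ge0 ?wedge_norm_ge0 ?(ltW nx) ?(ltW ny) //.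
by rewrite [leLHS]exprMn real_normK ?num_real // -exprMn.
Qed.

End ExamplePlane.

(** * Finiteness of the rational planes of bounded height *)

Section Northcott.
Variables (R : realType) (n : nat).
Implicit Types (B : {vspace 'rV[R]_n}).

(** The vectors [E k] have the minors as coordinates, so equal minors place them in both planes; r
    and s are recovered from [E i] and [E j] because the minor at (i, j) is nonzero. *)
Lemma plucker_subv B B' (M M' : 'M[R]_(2, n)) :
  basis_of B [tuple row i M | i < 2] -> basis_of B' [tuple row i M' | i < 2] ->
  plucker M =1 plucker M' -> (B <= B')%VS.
Proof.
move=> /basis2P[-> [i [j mij]]] /basis2P[EB' _] MM'.
set r := row ord0 M in mij *; set s := row ord_max M in mij *.
have mE k l : minor r s k l = minor (row ord0 M') (row ord_max M') k l.
  wlog kl : k l / (k < l)%N => [H|].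
    have [/H //|lk|/val_inj->] := ltngtP k l; last by rewrite /minor !subrr.
    by rewrite minorC H // -minorC.
  by have := MM' (plucker_pair kl); rewrite !plucker2 /= !ffunE.
pose E k : 'rV[R]_n := r 0 k *: s - s 0 k *: r.
have EB k : E k \in B'.
  have -> : E k = (row ord0 M' 0 k) *: row ord_max M' - (row ord_max M' 0 k) *: row ord0 M'.
    apply/rowP => l; transitivity (minor r s k l); first by rewrite /minor /E !mxE; ring.
    by rewrite mE /minor !mxE; ring.
  by rewrite EB' memvB // memvZ // memv_span // !inE eqxx ?orbT.
have comb v : v 0 i *: E j - v 0 j *: E i \in B' by rewrite memvB // memvZ.
apply/span_subvP => v; rewrite !inE => /orP[]/eqP->.
  have -> : r = - (minor r s i j)^-1 *: (r 0 i *: E j - r 0 j *: E i); last exact/memvZ/comb.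
  apply/rowP => l; move: mij; rewrite /minor /E !mxE => mij; by field.
have -> : s = - (minor r s i j)^-1 *: (s 0 i *: E j - s 0 j *: E i); last exact/memvZ/comb.
by apply/rowP => l; move: mij; rewrite /minor /E !mxE => mij; field.
Qed.

(** The primitive Plucker coordinates are integers bounded by the height, and they determine the
    plane. The shift by [N] encodes them as ordinals. *)
Lemma finite_height_le (K : R) :
  finite_set [set B : {vspace 'rV[R]_n} | rational_subspaces 2 B /\ height 2 B <= K].
Proof.
pose N := Num.truncn K.
pose I : finType := {ffun plucker_index n 2 -> 'I_(2 * N).+1}.
pose code B (g : I) := exists M : 'M[R]_(2, n), basis_of B [tuple row i M | i < 2] /\
  forall f, plucker M f = ((g f)%:Z - N%:Z)%:~R.
pose dec (g : I) : {vspace 'rV[R]_n} := xget 0%VS [set B | code B g].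
apply: (@sub_finite_set _ _ (dec @` setT)); last exact/finite_image/finite_finset.
move=> B [rB hK]; have [M [Xi [bM pM _ hE]]] := heightP rB.
have XiN f : (`|(Xi f + N%:Z)%R| < (2 * N).+1)%N /\ 0 <= Xi f + N%:Z.
  suff : (`|Xi f| <= N)%N by lia.
  rewrite truncn_ge_nat; last exact: le_trans ler01 (le_trans (height_ge1 rB) hK).
  rewrite pmulrn abszE intr_norm -pM plucker2; apply: le_trans (minor_wedge_le _ _ _ _) _.
  by rewrite -hE.
pose g : I := [ffun f => Ordinal (XiN f).1].
have cg : code B g.
  exists M; split=> // f; rewrite pM ffunE /= gez0_abs ?addrK //.
  by have [] := XiN f.
exists g => //; have [M' [bM' pM']] : [set B | code B g] (dec g) by apply: xgetPex; exists B.
apply/eqP; rewrite eqEsubv; apply/andP; split; [apply: plucker_subv bM' bM _|apply: plucker_subv bM bM' _].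
all: by move=> f; rewrite pM' pM ffunE /= gez0_abs ?addrK //; have [] := XiN f.
Qed.

End Northcott.

(** * Planes of exponent at most 3 + eps *)

Section UpperBound.
Variable R : realType.

Lemma plane_form_lower (eps t c : R) : 1 <= t <= 2 -> 0 < c ->
  (forall (N : nat) (m1 m2 m3 : int), (0 < N)%N -> (`|m1| <= N)%N -> (`|m2| <= N)%N ->
      ~ [/\ m1 = 0, m2 = 0 & m3 = 0] ->
      c * N%:R `^ (- (2 + eps)) <= `|quad m1 m2 m3 t|) ->
  0 < eps -> forall B, rational_subspaces 2 B -> exists r s : 'rV[R]_4,
  [/\ B = <<[:: r; s]>>%VS, height 2 B = wedge_norm r s &
  c * (2 * height 2 B) `^ (- (2 + eps)) <= 5 *
  `|plane_form (Num.sqrt 3 * (1 - t ^+ 2) / (1 + t ^+ 2)) (2 * Num.sqrt 3 * t / (1 + t ^+ 2)) r s|].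
Proof.
move=> /andP[t1 t2] c0 Hc eps0 B rB; have H1 := height_ge1 rB.
have [M [Xi [/basis2P[EB _] pM _ hE]]] := heightP rB.
exists (row ord0 M), (row ord_max M); split=> //.
set r := row ord0 M in EB hE *; set s := row ord_max M in EB hE *.
pose X (i j : 'I_4) (lij : (i < j)%N) := Xi (@plucker_pair 4 i j lij).
have XE (i j : 'I_4) (lij : (i < j)%N) : minor r s i j = (X i j lij)%:~R.
  by rewrite /X -pM plucker2 /= !ffunE.
pose X01 := X i0 i1 isT; pose X02 := X i0 i2 isT; pose X03 := X i0 i3 isT.
pose X12 := X i1 i2 isT; pose X13 := X i1 i3 isT; pose X23 := X i2 i3 isT.
have [x01 x02 x03] : [/\ minor r s i0 i1 = X01%:~R, minor r s i0 i2 = X02%:~R &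
  minor r s i0 i3 = X03%:~R] by split; apply: XE.
have [x12 x13 x23] : [/\ minor r s i1 i2 = X12%:~R, minor r s i1 i3 = X13%:~R &
  minor r s i2 i3 = X23%:~R] by split; apply: XE.
have pl : X01 * X23 - X02 * X13 + X03 * X12 = 0.
  apply/eqP; rewrite -(intr_eq0 R) !(rmorphD, rmorphN, rmorphM) /= -x01 -x02 -x03 -x12 -x13 -x23.
  by apply/eqP; rewrite /minor; ring.
pose m1 := X01 + X23; pose m2 := X02 - X13; pose m3 := X12 - 3 * X03.
(* If all three vanish, the Plucker relation [pl] becomes 3 (X01^2 + X02^2) = (3 X03)^2, so every
   coordinate is 0, although the height is at least 1. *)
have mn0 : ~ [/\ m1 = 0, m2 = 0 & m3 = 0].
  rewrite /m1 /m2 /m3 => -[e1 e2 e3].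
  have [z1 z2 z3] : [/\ X01 = 0, X02 = 0 & 3 * X03 = 0].
    apply: ternary_anisotropic; have E1 : X23 = - X01 by lia.
    have E2 : X13 = X02 by lia.
    have E3 : X12 = 3 * X03 by lia.
    by move: pl; rewrite E1 E2 E3; lia.
  have : wedge_norm r s ^+ 2 = 0.
    rewrite wedge_norm4 x01 x02 x03 x12 x13 x23.
    have [-> [-> ->]] : X03 = 0 /\ X12 = 0 /\ X13 = 0 by lia.
    have -> : X23 = 0 by lia.
    by rewrite z1 z2 !expr0n !addr0.
  by move/eqP; rewrite -hE sqrf_eq0 gt_eqF // (lt_le_trans ltr01).
have Xh (i j : 'I_4) lij : `|(X i j lij)%:~R| <= height 2 B by rewrite -XE hE minor_wedge_le.
(* The 1 keeps N positive when m1 = m2 = 0; it is also below 2 H since H >= 1. *)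
pose N := maxn 1 (maxn `|m1| `|m2|).
have NH : N%:R <= 2 * height 2 B.
  have mH (p q : int) : `|p%:~R| <= height 2 B -> `|q%:~R| <= height 2 B ->
      `|(p + q)%:~R : R| <= 2 * height 2 B.
    by move=> hp hq; rewrite rmorphD /=; apply: le_trans (ler_normD _ _) _; lra.
  have absE (m : int) : `|m|%N%:R = `|m%:~R : R| by rewrite pmulrn abszE intr_norm.
  rewrite /N; case: (leqP 1 (maxn _ _)) => _; last by lra.
  case: (leqP `|m1| `|m2|) => _; rewrite absE; apply: mH; rewrite ?Xh //.
  by rewrite rmorphN normrN Xh.
have N0 : (0 < N)%N by rewrite leq_max.
have := Hc N m1 m2 m3 N0 _ _ mn0; rewrite !leq_max !leqnn !orbT => /(_ isT isT) hq.
have p0 : 0 < 1 + t ^+ 2 by rewrite ltr_pwDl // sqr_ge0.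
have p5 : 1 + t ^+ 2 <= 5 by have := ler_pXn2r (n := 2); nra.
have qE : quad m1 m2 m3 t = (1 + t ^+ 2) * plane_form
   (Num.sqrt 3 * (1 - t ^+ 2) / (1 + t ^+ 2)) (2 * Num.sqrt 3 * t / (1 + t ^+ 2)) r s.
  rewrite /quad /plane_form x01 x02 x03 x12 x13 x23.
  rewrite /m1 /m2 /m3 !(rmorphD, rmorphN, rmorphM) /=; field; by rewrite gt_eqF.
apply: (@le_trans _ _ (c * N%:R `^ (- (2 + eps)))).
  rewrite ler_wpM2l ?(ltW c0) // !powRN lef_pV2 ?posrE ?powR_gt0 ?ltr0n //; last by lra.
  by apply: ge0_ler_powR; rewrite ?nnegrE ?addr_ge0 ?(ltW eps0) //; lra.
apply: le_trans hq _; rewrite qE normrM (gtr0_norm p0).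
by rewrite ler_wpM2r.
Qed.

Lemma good_plane (eps : R) : 0 < eps -> exists (A : {vspace 'rV[R]_4}) (c : R),
  [/\ \dim A = 2, 0 < c & forall B, rational_subspaces 2 B ->
   forall x y, x \in A -> x != 0 -> y \in B -> y != 0 ->
     c * height 2 B `^ (- (3 + eps)) <= psi x y].
Proof.
move=> eps0; have [t [c [t12 c0 Hc]]] := badly_approximable_point eps0.
pose a := Num.sqrt 3 * (1 - t ^+ 2) / (1 + t ^+ 2).
pose b := 2 * Num.sqrt 3 * t / (1 + t ^+ 2).
have p0 : 0 < 1 + t ^+ 2 by rewrite ltr_pwDl // sqr_ge0.
have ab : a ^+ 2 + b ^+ 2 = 3.
  have s2 : Num.sqrt 3 ^+ 2 = 3 :> R by rewrite sqr_sqrtr.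
  rewrite /a /b !exprMn !exprVn s2; field; by rewrite gt_eqF.
(* The 20 combines the 5 bounding 1 + t^2 with the 4 of [psi_ge_plane_form]; the power of 2 comes
   from the bound N <= 2 H. *)
exists <<[:: plane_u a b; plane_v a b]>>%VS, (c / 20 * 2 `^ (- (2 + eps))); split.
- have : free [:: plane_u a b; plane_v a b].
    apply/free2_minor; exists i0, i3; rewrite /minor !mxE /=.
    by rewrite mulr1 mulr0 subr0 oner_neq0.
  by move/eqP.
- by rewrite mulr_gt0 ?powR_gt0 // divr_gt0.
move=> B rB x y xA x0 yB y0.
have [r [s [EB hE hL]]] := plane_form_lower t12 c0 Hc eps0 rB.
rewrite EB in yB; have := psi_ge_plane_form ab xA x0 yB y0; rewrite -hE => hpsi.
have H1 := height_ge1 rB; have H0 : 0 < height 2 B by lra.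
rewrite -/a -/b in hL.
have : c * (2 * height 2 B) `^ (- (2 + eps)) <= 20 * (height 2 B * psi x y).
  by apply: le_trans hL _; move: hpsi; clear; lra.
rewrite powRM ?(ltW H0) // => h.
have -> : - (3 + eps) = - (2 + eps) + - 1 by ring.
rewrite powRD ?(gt_eqF H0) ?implybT // powR_inv1 ?(ltW H0) //.
rewrite mulrA ler_pdivrMr //; move: h.
set u := 2 `^ _; set v := height 2 B `^ _; clear; lra.
Qed.

(** A common nonzero vector of A and B would give [psi] the value 0, so A is irrational. For beta >
    3 + eps the two bounds on psi_1 give H^(beta - 3 - eps) <= 1/c, which leaves finitely many
    planes. *)
Lemma mu_le (eps : R) : 0 < eps ->
  exists2 A : {vspace 'rV[R]_4}, irrational_subspaces 2 2 1 A & (mu A 2 1 <= (3 + eps)%:E)%E.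
Proof.
move=> eps0; have [A [c [dimA c0 HA]]] := good_plane eps0.
exists A.
  split=> // B rB; rewrite ltnS leqn0 dimv_eq0; apply: contraT => AB0.
  have := memv_pick (A :&: B); rewrite memv_cap => /andP[xA xB].
  have x0 : vpick (A :&: B) != 0 by rewrite vpick0.
  have := HA B rB _ _ xA x0 xB x0.
  have -> : psi (vpick (A :&: B)) (vpick (A :&: B)) = 0.
    rewrite /psi (_ : wedge_norm _ _ = 0) ?mul0r //.
    apply/eqP; rewrite -sqrf_eq0 wedge_norm_sqr big1 // => p _.
    by rewrite /minor mulrC subrr expr0n.
  by rewrite leNgt mulr_gt0 // powR_gt0 // (lt_le_trans ltr01) // height_ge1.
rewrite /mu ge_max lee_fin addr_ge0 ?(ltW eps0) //=.
apply: ge_ereal_sup => _ [beta [beta0 inf_beta] <-]; rewrite lee_fin leNgt; apply/negP => lt_beta.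
apply: inf_beta; pose del := beta - (3 + eps).
have del0 : 0 < del by rewrite subr_gt0.
apply: sub_finite_set (finite_height_le 4 (c^-1 `^ del^-1)) => B [rB psiB]; split=> //.
have H1 := height_ge1 rB; have H0 : 0 < height 2 B by apply: lt_le_trans H1.
have hc : c * height 2 B `^ (- (3 + eps)) <= height 2 B `^ (- beta).
  (* The bound on all values of [psi] passes to their infimum because A and B contain nonzero
     vectors; [inf] of an empty set would be a default value. *)
  apply: le_trans psiB; apply: lb_le_inf => [|_ [x [y [xA x0 yB y0 ->]]]]; last exact: HA.
  have [x xA x0] : exists2 x, x \in A & x != 0.
    by exists (vpick A); rewrite ?memv_pick // vpick0 -dimv_eq0 dimA.
  have [y yB y0] : exists2 y, y \in B & y != 0.
    exists (vpick B); rewrite ?memv_pick // vpick0 -dimv_eq0.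
    by have [M [Xi [/size_basis e _ _ _]]] := heightP rB; apply/eqP => d0; rewrite d0 in e.
  by exists (psi x y), x, y.
have hdel : height 2 B `^ del <= c^-1.
  rewrite -[leRHS]mul1r ler_pdivlMr // mulrC /del powRD ?(gt_eqF H0) ?implybT // mulrCA.
  have e1 : height 2 B `^ beta * height 2 B `^ (- beta) = 1.
    by rewrite -powRD ?(gt_eqF H0) ?implybT // subrr powRr0.
  by rewrite -[leRHS]e1; apply: ler_wpM2l hc; exact: powR_ge0.
have -> : height 2 B = (height 2 B `^ del) `^ del^-1.
  by rewrite -powRrM mulfV ?(gt_eqF del0) // powRr1 // ltW.
apply: ge0_ler_powR => //; rewrite ?nnegrE ?powR_ge0 ?invr_ge0 ?(ltW c0) //.
exact: ltW.
Qed.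

End UpperBound.

Theorem theorem1p5 (R : realType) : mu_inf R 4 2 2 1 = (3%:R%:E)%E.
Proof.
apply/eqP; rewrite eq_le; apply/andP; split.
  (* The plane may vary with [eps], since the infimum runs over all irrational planes. *)
  apply/lee_addgt0Pr => eps eps0; have [A irrA muA] := mu_le eps0.
  by apply: le_trans muA; apply: ereal_inf_lbound; exists A.
apply: le_ereal_inf_tmp => _ [A irrA <-]; exact: mu_ge3.
Qed.
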